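(* Let $\mathcal{A}=\mathcal{A}_n^{\bar q,\Lambda}(\mathbb{K})$ with generators $x_1,y_1,\dots,x_n,y_n$ and $\mathcal{C}=\mathcal{A}_m^{\bar q',\Lambda'}(\mathbb{K})$ with generators $x'_1,y'_1,\dots,x'_m,y'_m$, and assume no $q_i$ and no $q'_i$ is a root of unity. Then $\mathcal{A}\cong\mathcal{C}$ as $\mathbb{K}$-algebras if and only if $m=n$ and there exist a partition $\{1,\dots,n\}=P_1\cup P_2$ and a permutation $\sigma$ of $\{1,\dots,n\}$ such that: $q'_{\sigma(i)}=q_i$ for $i\in P_1$; $q'_{\sigma(i)}=q_i^{-1}$ for $i\in P_2$; $\lambda'_{\sigma(i)\sigma(j)}=\lambda_{ij}$ whenever $i,j$ lie in the same part; and $\lambda'_{\sigma(j)\sigma(i)}=\lambda_{ij}$ whenever $i\in P_1,j\in P_2$. In that case, for any $\alpha_1,\dots,\alpha_n\in\mathbb{K}^*$, an isomorphism $\varphi:\mathcal{A}\to\mathcal{C}$ is given by $\varphi(x_i)=\alpha_ix'_{\sigma(i)},\ \varphi(y_i)=\alpha_i^{-1}y'_{\sigma(i)}$ for $i\in P_1$ and $\varphi(x_i)=\alpha_iy'_{\sigma(i)},\ \varphi(y_i)=-q_i^{-1}\alpha_i^{-1}x'_{\sigma(i)}$ for $i\in P_2$.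
   Context: For a field $\mathbb{K}$, $n\ge 1$, $\bar q=(q_1,\dots,q_n)\in(\mathbb{K}^* )^n$, and $\Lambda=(\lambda_{ij})$ an $n\times n$ matrix over $\mathbb{K}^*$ with $\lambda_{ij}=\lambda_{ji}^{-1}$, $\lambda_{ii}=1$, $\mathcal{A}_n^{\bar q,\Lambda}(\mathbb{K})$ is the $\mathbb{K}$-algebra generated by $x_1,y_1,\dots,x_n,y_n$ with relations: for $1\le i<j\le n$, $x_ix_j=\lambda_{ij}x_jx_i$, $y_jy_i=\lambda_{ji}y_iy_j$, $x_iy_j=\lambda_{ji}y_jx_i$, $x_jy_i=\lambda_{ij}y_ix_j$; and $x_iy_i-q_iy_ix_i=1$ for all $i$. The algebra $\mathcal{C}$ is defined in the same way from data $(m,\bar q'=(q'_1,\dots,q'_m),\Lambda'=(\lambda'_{ij}))$. *)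

(* Defs.v *)
From HB Require Import structures.
From mathcomp Require Import all_boot all_order all_algebra.
Set Implicit Arguments. Unset Strict Implicit. Unset Printing Implicit Defensive.
Import Order.TTheory GRing.Theory Num.Theory.
Local Open Scope ring_scope.

Definition qweyl_data (K : fieldType) (n : nat) (q : 'I_n -> K)
    (L : 'I_n -> 'I_n -> K) : Prop :=
  [/\ (0 < n)%N, (forall i, q i != 0), (forall i j, L i j != 0),
      (forall i j, L i j = (L j i)^-1) & (forall i, L i i = 1)].

Definition not_root_of_unity (K : fieldType) (a : K) : Prop :=
  forall k : nat, (0 < k)%N -> a ^+ k != 1.

Definition qweyl_rel (K : fieldType) (B : algType K) (n : nat)
    (q : 'I_n -> K) (L : 'I_n -> 'I_n -> K) (x y : 'I_n -> B) : Prop :=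
  (forall i j : 'I_n, (i < j)%N ->
     [/\ x i * x j = L i j *: (x j * x i),
         y j * y i = L j i *: (y i * y j),
         x i * y j = L j i *: (y j * x i) &
         x j * y i = L i j *: (y i * x j)]) /\
  (forall i : 'I_n, x i * y i - q i *: (y i * x i) = 1).

(* A (with the distinguished elements x, y) is the K-algebra presented by the
   generators x_i, y_i and the relations above, i.e. it satisfies the
   universal property of the algebra given by generators and relations. *)
Definition is_qweyl (K : fieldType) (A : algType K) (n : nat)
    (q : 'I_n -> K) (L : 'I_n -> 'I_n -> K) (x y : 'I_n -> A) : Prop :=
  qweyl_rel q L x y /\
  forall (B : algType K) (xB yB : 'I_n -> B), qweyl_rel q L xB yB ->
    exists f : {lrmorphism A -> B},
      (forall i, f (x i) = xB i /\ f (y i) = yB i) /\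
      (forall g : {lrmorphism A -> B},
         (forall i, g (x i) = xB i /\ g (y i) = yB i) -> g =1 f).

Definition qweyl_iso_cond (K : fieldType) (n m : nat)
    (q : 'I_n -> K) (L : 'I_n -> 'I_n -> K)
    (q' : 'I_m -> K) (L' : 'I_m -> 'I_m -> K)
    (P1 : {set 'I_n}) (sigma : 'I_n -> 'I_m) : Prop :=
  [/\ (forall i, i \in P1 -> q' (sigma i) = q i),
      (forall i, i \notin P1 -> q' (sigma i) = (q i)^-1),
      (forall i j, (i \in P1) = (j \in P1) -> L' (sigma i) (sigma j) = L i j) &
      (forall i j, i \in P1 -> j \notin P1 -> L' (sigma j) (sigma i) = L i j)].

(* Main.v *)
Require Import Defs.
From HB Require Import structures.
From mathcomp Require Import all_boot all_order all_algebra.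
From mathcomp Require Import boolp finmap monalg zify ring.
Import Order.TTheory GRing.Theory Num.Theory.
Set Implicit Arguments.
Unset Strict Implicit.
Unset Printing Implicit Defensive.
Local Open Scope ring_scope.

(* Put z_i = x_i y_i - y_i x_i. The algebra embeds into the quantum torus generated
   by invertible X_i, Z_i, by x_i |-> X_i and y_i |-> (q_i - 1)^-1 (Z_i - 1) X_i^-1, so
   that z_i |-> Z_i. The torus is a domain graded by an ordered group; comparing the
   highest and the lowest terms in u Z_i = w u and u X_i = w' u shows that a normal
   element u of the algebra is a scalar multiple of a monomial in the torus, and
   u y_i = w u then forces it to be a scalar multiple of a monomial in the z_i. An
   isomorphism therefore permutes the z_i up to scalars. The commutation with the
   z'_j gives the degree of the image of x_i, so this image is f x'_k or f y'_k; as
   the same holds for the inverse, f is a unit, hence a scalar, and the parameters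
   are read off. *)

(** The algebra is known only through its universal property, which gives maps out of it but no
    basis. That the products of the powers z_i^s x_i^t span, with y_i standing for the negative
    powers of x_i, comes from an induction on generators; their independence comes from the torus,
    where in the reversed order the top exponent of such a product is its own exponent vector.
    Injectivity of the embedding follows from the same comparison. The image of y_i is not a
    monomial, and this asymmetry with x_i shapes the argument. How a normal element commutes with
    x_i and z_i is read off exponents; for y_i this is replaced by the fact that x_i has no left
    inverse. The torus has units that the algebra lacks, and they are kept out because exponents of
    Z_i are never negative on the image. Besides making q_i - 1 invertible, the assumption on roots
    of unity enters through one device: the scalar q_i^e determines the integer e, so commutation
    scalars become degrees. *)

Section LinearExtension.
Variables (K : fieldType) (G : choiceType) (V : lmodType K).
Implicit Types (f : G -> V) (g : {malg K[G]}) (k : G).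

Definition lext f g : V := \sum_(k <- msupp g) g@_k *: f k.

(** Padding with zero coefficients gives several elements a common index set, as the proof of
    linearity requires. *)
Lemma lextw f g (d : {fset G}) :
  (msupp g `<=` d)%fset -> lext f g = \sum_(k <- d) g@_k *: f k.
Proof.
move=> le_gd; apply: big_fset_incl => // k _.
by move=> /mcoeff_outdom ->; rewrite scale0r.
Qed.

Lemma lext_is_linear f : linear (lext f).
Proof.
move=> a g h; pose d := (msupp g `|` msupp h)%fset.
have le1 : (msupp (a *: g) `<=` d)%fset.
  exact: fsubset_trans (msuppZ_le _ _) (fsubsetUl _ _).
have le2 : (msupp (a *: g + h) `<=` d)%fset.
  by apply: fsubset_trans (msuppD_le _ _) _; rewrite fsubUset le1 fsubsetUr.
rewrite (lextw f le2) (lextw f (fsubsetUl (msupp g) (msupp h))).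
rewrite (lextw f (fsubsetUr (msupp g) (msupp h))) scaler_sumr -big_split /=.
by apply: eq_bigr => k _; rewrite mcoeffD mcoeffZ scalerDl scalerA.
Qed.
HB.instance Definition _ f :=
  GRing.isLinear.Build K {malg K[G]} V *:%R (lext f) (lext_is_linear f).

Lemma lextZ f a g : lext f (a *: g) = a *: lext f g.
Proof. exact: linearZ_LR. Qed.
Lemma lextD f g h : lext f (g + h) = lext f g + lext f h.
Proof. exact: linearD. Qed.

Lemma lextU f c k : lext f << c *g k >> = c *: f k.
Proof.
rewrite (lextw f msuppU_le) big_seq_fset1 mcoeffU eqxx //.
Qed.

Lemma lextU2 f a b k l : lext f (<< a *g k >> + << b *g l >>) = a *: f k + b *: f l.
Proof. by rewrite lextD !lextU. Qed.

Lemma malg_linear_ext (f1 f2 : {linear {malg K[G]} -> V}) :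
  (forall k, f1 << k >> = f2 << k >>) -> f1 =1 f2.
Proof.
have UE c k : << c *g k >> = c *: << k >> :> {malg K[G]}.
  by apply/malgP => l; rewrite mcoeffZ !mcoeffU mulr_natr.
move=> f12 g; rewrite [g]monalgE !linear_sum; apply: eq_bigr => k _.
by rewrite UE !linearZ_LR f12.
Qed.

End LinearExtension.

(** * Twisted group algebras *)

Record bichar (K : fieldType) (G : zmodType) := Bichar {
  bchar :> G -> G -> K;
  bcharDl : forall k l p, bchar (k + l) p = bchar k p * bchar l p;
  bcharDr : forall k l p, bchar k (l + p) = bchar k l * bchar k p;
  bchar_neq0 : forall k l, bchar k l != 0 }.

(* The twisted group algebra of G: the product of the basis elements k and l is
   the scalar multiple c k l of the basis element k + l. *)
Definition qtorus (K : fieldType) (G : zmodType) (c : bichar K G) : Type :=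
  {malg K[G]}.

Section QuantumTorus.
Variables (K : fieldType) (G : zmodType) (c : bichar K G).
Local Notation T := (qtorus c).
HB.instance Definition _ := GRing.Lmodule.on T.

Lemma bchar0l k : c 0 k = 1.
Proof.
apply: (mulfI (bchar_neq0 c 0 k)).
by rewrite -(bcharDl c 0 0 k) addr0 mulr1.
Qed.

Lemma bchar0r k : c k 0 = 1.
Proof.
apply: (mulfI (bchar_neq0 c k 0)).
by rewrite -(bcharDr c k 0 0) addr0 mulr1.
Qed.

Definition qmon (k : G) : T := << k >>.
Definition qcoef (k : G) (t : T) : K := t@_k.

(* The unit and the product are locked: otherwise unification unfolds them. *)
Fact torus_key : unit. Proof. by []. Qed.
Definition tone : T := locked_with torus_key (qmon 0).
Definition tmul : T -> T -> T := locked_with torus_key (fun g h =>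
  lext (fun k => lext (fun l => c k l *: qmon (k + l)) h) g).

Lemma toneE : tone = qmon 0. Proof. by rewrite /tone unlock. Qed.
Lemma tmulE g h :
  tmul g h = lext (fun k => lext (fun l => c k l *: qmon (k + l)) h) g.
Proof. by rewrite /tmul unlock. Qed.

Definition tmulr (h : T) (g : T) := tmul g h.

Lemma tmul_is_linear g : linear (tmul g).
Proof.
move=> a h1 h2; rewrite !tmulE /lext scaler_sumr -big_split /=.
apply: eq_bigr => k _; rewrite !scalerA mulrC -scalerA -scalerDr.
congr (_ *: _); exact: (linearP (lext (fun l => c k l *: qmon (k + l)))).
Qed.
HB.instance Definition _ g :=
  GRing.isLinear.Build K T T *:%R (tmul g) (tmul_is_linear g).
Lemma tmulr_is_linear g : linear (tmulr g).
Proof. by move=> a h1 h2; rewrite /tmulr !tmulE linearP. Qed.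
HB.instance Definition _ g :=
  GRing.isLinear.Build K T T *:%R (tmulr g) (tmulr_is_linear g).

Lemma tmulU k l : tmul (qmon k) (qmon l) = c k l *: qmon (k + l).
Proof. by rewrite tmulE !lextU !scale1r. Qed.

Lemma tlin_ext (f1 f2 : {linear T -> T}) :
  (forall k, f1 (qmon k) = f2 (qmon k)) -> f1 =1 f2.
Proof. exact: malg_linear_ext. Qed.

(** Both sides are linear in each of the three arguments, so basis elements suffice. There the
    bimultiplicativity of [c] gives the 2-cocycle identity. *)
Lemma tmulA : associative tmul.
Proof.
move=> f g h.
pose F1 : {linear T -> T} := tmulr (tmul g h).
pose F2 : {linear T -> T} := tmulr h \o tmulr g.
apply: (tlin_ext (f1 := F1) (f2 := F2)) f => k; rewrite /F1 /F2 /= /tmulr {F1 F2}.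
pose F3 : {linear T -> T} := tmul (qmon k) \o tmulr h.
pose F4 : {linear T -> T} := tmulr h \o tmul (qmon k).
apply: (tlin_ext (f1 := F3) (f2 := F4)) g => l; rewrite /F3 /F4 /= /tmulr {F3 F4}.
pose F5 : {linear T -> T} := tmul (qmon k) \o tmul (qmon l).
pose F6 : {linear T -> T} := tmul (tmul (qmon k) (qmon l)).
apply: (tlin_ext (f1 := F5) (f2 := F6)) h => p; rewrite /F5 /F6 /=.
rewrite !tmulU linearZ /= tmulU.
have -> : tmul (c k l *: qmon (k + l)) (qmon p) = c k l *: tmul (qmon (k + l)) (qmon p).
  exact: (linearZ_LR (tmulr (qmon p) : {linear T -> T})).
rewrite tmulU !scalerA addrA.
by rewrite bcharDl bcharDr; congr (_ *: _); ring.
Qed.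

Lemma tmul1l : left_id tone tmul.
Proof.
rewrite toneE; apply: (tlin_ext (f1 := tmul (qmon 0)) (f2 := idfun)) => k.
by rewrite /= tmulU bchar0l add0r scale1r.
Qed.

Lemma tmul1r : right_id tone tmul.
Proof.
rewrite toneE; apply: (tlin_ext (f1 := tmulr (qmon 0)) (f2 := idfun)) => k.
by rewrite /= /tmulr tmulU bchar0r addr0 scale1r.
Qed.

Lemma tmulDl : left_distributive tmul +%R.
Proof. by move=> f g h; apply: (linearD (tmulr h : {linear T -> T})). Qed.
Lemma tmulDr : right_distributive tmul +%R.
Proof. by move=> f g h; apply: linearD. Qed.
Lemma tone_neq0 : tone != 0.
Proof. by rewrite toneE monalgU_eq0 oner_neq0. Qed.

HB.instance Definition _ := GRing.Zmodule_isNzRing.Build T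
  tmulA tmul1l tmul1r tmulDl tmulDr tone_neq0.
Lemma tscaleAl (a : K) (g h : T) : a *: (g * h) = (a *: g) * h.
Proof. by symmetry; apply: (linearZ_LR (tmulr h : {linear T -> T})). Qed.
HB.instance Definition _ := GRing.Lmodule_isLalgebra.Build K T tscaleAl.
Lemma tscaleAr (a : K) (g h : T) : a *: (g * h) = g * (a *: h).
Proof. by symmetry; apply: (linearZ_LR (tmul g : {linear T -> T})). Qed.
HB.instance Definition _ := GRing.Lalgebra_isAlgebra.Build K T tscaleAr.

Lemma qmonM k l : qmon k * qmon l = c k l *: qmon (k + l).
Proof. exact: tmulU. Qed.

Lemma qmon0 : qmon 0 = 1. Proof. by rewrite -toneE. Qed.

Lemma qcoef_is_linear k : linear (qcoef k : T -> K^o).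
Proof. by move=> a s t; rewrite /qcoef mcoeffD mcoeffZ. Qed.
HB.instance Definition _ k :=
  GRing.isLinear.Build K T K^o *:%R (qcoef k) (qcoef_is_linear k).

Lemma qcoefZ k a (t : T) : qcoef k (a *: t) = a * qcoef k t.
Proof. exact: mcoeffZ. Qed.

Lemma qcoef0 k : qcoef k 0 = 0. Proof. exact: mcoeff0. Qed.
Lemma qcoefD k (s t : T) : qcoef k (s + t) = qcoef k s + qcoef k t.
Proof. exact: mcoeffD. Qed.
Lemma qcoefB k (s t : T) : qcoef k (s - t) = qcoef k s - qcoef k t.
Proof. exact: mcoeffB. Qed.
Lemma qcoef_sum k (I : Type) (r : seq I) (Pr : pred I) (F : I -> T) :
  qcoef k (\sum_(i <- r | Pr i) F i) = \sum_(i <- r | Pr i) qcoef k (F i).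
Proof. exact: linear_sum. Qed.

Lemma qcoef_mon k l : qcoef l (qmon k) = (k == l)%:R.
Proof. by rewrite /qcoef mcoeffU. Qed.

Lemma qcoefP (s t : T) : (forall k, qcoef k s = qcoef k t) -> s = t.
Proof. by move=> st; apply/malgP => k; apply: st. Qed.

(** The hypothesis covers the case of [p] outside the support, where the sum is empty of nonzero
    terms. *)
Lemma qcoef_sumE (t : T) (F : G -> K) p : (qcoef p t = 0 -> F p = 0) ->
  \sum_(l <- msupp (t : {malg K[G]})) F l *+ (l == p) = F p.
Proof.
move=> F0; have [pt|pt] := boolP (p \in msupp (t : {malg K[G]})).
  rewrite (bigD1_seq p) ?fset_uniq //= eqxx big1 ?addr0 // => l /negPf ->.
  by rewrite mulr0n.
rewrite F0 ?big1_seq //; last exact: mcoeff_outdom.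
by move=> l /= lt; case: eqP lt pt => // -> ->.
Qed.

Lemma qcoefM (s t : T) p : qcoef p (s * t) =
  \sum_(k <- msupp (s : {malg K[G]})) qcoef k s * qcoef (p - k) t * c k (p - k).
Proof.
have -> : s * t = \sum_(k <- msupp (s : {malg K[G]})) qcoef k s *: (qmon k * t).
  rewrite -[LHS]/(tmul s t) tmulE {1}/lext; apply: eq_bigr => k _.
  by rewrite -[qmon k * t]/(tmul (qmon k) t) tmulE lextU scale1r.
rewrite linear_sum /=; apply: eq_bigr => k _; rewrite qcoefZ -mulrA; congr (_ * _).
have -> : qmon k * t =
    \sum_(l <- msupp (t : {malg K[G]})) qcoef l t *: (c k l *: qmon (k + l)).
  by rewrite -[LHS]/(tmul (qmon k) t) tmulE lextU scale1r.
rewrite linear_sum /= -(@qcoef_sumE t (fun l => qcoef l t * c k l)); last first.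
  by move=> ->; rewrite mul0r.
apply: eq_bigr => l _; rewrite !qcoefZ qcoef_mon mulrA mulr_natr.
by rewrite (can2_eq (addKr _) (addNKr _)) [- k + p]addrC.
Qed.

Lemma qcoef_monM k (t : T) p : qcoef p (qmon k * t) = c k (p - k) * qcoef (p - k) t.
Proof.
rewrite qcoefM /qmon msuppU oner_eq0 big_seq_fset1 -/(qmon k) qcoef_mon eqxx.
by rewrite mul1r mulrC.
Qed.

Lemma qcoefM_mon k (t : T) p : qcoef p (t * qmon k) = c (p - k) k * qcoef (p - k) t.
Proof.
rewrite qcoefM -(@qcoef_sumE t (fun l => c l k * qcoef l t)); last first.
  by move=> ->; rewrite mulr0.
apply: eq_bigr => l _; rewrite qcoef_mon.
have -> : (k == p - l) = (l == p - k) by rewrite eq_sym [RHS]eq_sym !subr_eq addrC.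
case: eqP => [->|_]; last by rewrite mulr0 mul0r.
by rewrite mulr1 subKr mulrC.
Qed.

Lemma qcoefM_neq0 (s t : T) p : qcoef p (s * t) != 0 ->
  exists k l, [/\ qcoef k s != 0, qcoef l t != 0 & p = k + l].
Proof.
rewrite qcoefM => sp.
have /hasP [j js tj] : has (fun j => qcoef (p - j) t != 0) (msupp (s : {malg K[G]})).
  apply: contraR sp => /hasPn H; rewrite big1_seq // => j /H /negPn/eqP ->.
  by rewrite mulr0 mul0r.
by exists j, (p - j); rewrite subrKC; split; rewrite // /qcoef mcoeff_neq0.
Qed.

(** Left and right multiplication by a monomial shift exponents alike, so the coefficients at
    [l + k] involve only the coefficient of [u] at [l]. One commutation scalar thus constrains every
    exponent of the support. *)
Lemma qmon_comm_supp k g (u : T) l :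
  u * qmon k = g *: (qmon k * u) -> qcoef l u != 0 -> c l k = g * c k l.
Proof.
move=> /(congr1 (qcoef (l + k))); rewrite qcoefZ qcoefM_mon qcoef_monM addrK.
by rewrite mulrA => h ul; apply: (mulIf ul).
Qed.

(** * Group orders, given by their positive cones, and top exponents *)

Record cone := Cone {
  cpos :> pred G;
  cpos0 : ~~ cpos 0;
  cposD : forall k l, cpos k -> cpos l -> cpos (k + l);
  cpos_total : forall k, k != 0 -> cpos k || cpos (- k) }.

Definition is_top (P : cone) (t : T) (k : G) : Prop :=
  qcoef k t != 0 /\ forall l, qcoef l t != 0 -> l != k -> P (k - l).

Section Top.
Variable P : cone.

Lemma cpos_asym k : P k -> ~~ P (- k).
Proof.
move=> Pk; apply/negP => /(cposD Pk); rewrite subrr; exact/negP/cpos0.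
Qed.

Lemma seq_top (s : seq G) : s != [::] ->
  exists2 k, k \in s & forall l, l \in s -> l != k -> P (k - l).
Proof.
elim: s => // j s IH _; case: (eqVneq s [::]) IH => [-> _|_ /(_ isT) [k ks Hk]].
  by exists j; rewrite ?mem_head // => l; rewrite inE => ->.
case: (eqVneq j k) => [->|jk].
  exists k; rewrite ?mem_head // => l; rewrite inE => /predU1P [->|/Hk //].
  by rewrite eqxx.
have := cpos_total P (k := j - k); rewrite subr_eq0 jk => /(_ isT).
rewrite opprB => /orP [Pjk|Pkj].
  exists j; rewrite ?mem_head // => l; rewrite inE => /predU1P [->|ls lj].
    by rewrite eqxx.
  case: (eqVneq l k) => [->|lk] //.
  by have := cposD Pjk (Hk _ ls lk); rewrite addrA subrK.
exists k; first by rewrite inE ks orbT.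
by move=> l; rewrite inE => /predU1P [->|/Hk].
Qed.

Lemma ex_top (t : T) : t != 0 -> exists k, is_top P t k.
Proof.
move=> t0; have : (msupp (t : {malg K[G]}) : seq G) != [::].
  apply: contra t0 => /eqP h; apply/eqP/qcoefP => k; rewrite linear0.
  by apply: mcoeff_outdom; rewrite -[_ \in _]/(k \in (msupp _ : seq G)) h.
move=> /seq_top [k kt Hk]; exists k; split; first by rewrite /qcoef mcoeff_neq0.
by move=> l; rewrite /qcoef mcoeff_neq0; apply: Hk.
Qed.

Lemma is_top_neq0 (t : T) k : is_top P t k -> t != 0.
Proof. by case=> tk _; apply: contraNneq tk => ->; rewrite linear0. Qed.

Lemma is_top_uniq (t : T) k l : is_top P t k -> is_top P t l -> k = l.
Proof.
move=> [tk Hk] [tl Hl]; apply/eqP; apply: contraT => kl.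
have := Hk _ tl; rewrite eq_sym kl => /(_ isT) /cpos_asym.
by rewrite opprB Hl.
Qed.

(** An exponent [j] of [s] other than [k] lies below [k], so [k + l - j] lies above [l], outside the
    support of [t]. The coefficient at [k + l] is therefore a single nonzero product. *)
Lemma is_top_mul (s t : T) k l :
  is_top P s k -> is_top P t l -> is_top P (s * t) (k + l).
Proof.
move=> [sk Hk] [tl Hl].
have E j : qcoef j s != 0 -> qcoef (k + l - j) t != 0 -> j = k.
  move=> sj tj; apply/eqP; apply: contraT => jk.
  have kljl : k + l - j != l.
    by rewrite subr_eq [k + l]addrC (inj_eq (addrI l)) eq_sym.
  have := Hl _ tj kljl; rewrite opprB addrCA (addrC k) opprD addNKr => Pjk.
  by have := cpos_asym (Hk _ sj jk); rewrite opprB Pjk.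
split.
  rewrite qcoefM (bigD1_seq k) ?fset_uniq //=; last by rewrite -mcoeff_neq0.
  rewrite big1_seq ?addr0.
    by rewrite addrAC subrr add0r !mulf_neq0 // bchar_neq0.
  move=> j /andP [jk]; rewrite -mcoeff_neq0 -/(qcoef j s) => sj.
  case: (eqVneq (qcoef (k + l - j) t) 0) => [->|]; first by rewrite mulr0 mul0r.
  by move=> /(E _ sj)/eqP; rewrite (negPf jk).
move=> p /qcoefM_neq0 [j [r [sj tr ->]]] jrkl; rewrite opprD addrACA.
case: (eqVneq j k) jrkl => [->|jk _].
  by rewrite (inj_eq (addrI k)) subrr add0r; apply: Hl.
case: (eqVneq r l) => [->|rl]; first by rewrite subrr addr0 Hk.
by apply: cposD; [apply: Hk | apply: Hl].
Qed.

Lemma is_top_mon k a : a != 0 -> is_top P (a *: qmon k) k.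
Proof.
move=> a0; split; first by rewrite qcoefZ qcoef_mon eqxx mulr1.
move=> l; rewrite qcoefZ qcoef_mon; case: (k =P l) => [->|_]; first by rewrite eqxx.
by rewrite mulr0 eqxx.
Qed.

End Top.

(** The opposite order: its tops are the lowest exponents, so every fact about tops also serves for
    bottoms. *)
Definition ocone_pos (P : cone) : pred G := fun k => P (- k).
Lemma ocone_pos0 (P : cone) : ~~ ocone_pos P 0.
Proof. by rewrite /ocone_pos oppr0 cpos0. Qed.
Lemma ocone_posD (P : cone) k l :
  ocone_pos P k -> ocone_pos P l -> ocone_pos P (k + l).
Proof. by rewrite /ocone_pos opprD; apply: cposD. Qed.
Lemma ocone_total (P : cone) k : k != 0 -> ocone_pos P k || ocone_pos P (- k).
Proof. by move=> k0; apply: cpos_total; rewrite oppr_eq0. Qed.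
Definition ocone (P : cone) : cone :=
  Cone (ocone_pos0 P) (@ocone_posD P) (@ocone_total P).

Section Domain.
Variable P : cone.

Lemma qtorus_mulf_neq0 (s t : T) : s != 0 -> t != 0 -> s * t != 0.
Proof.
move=> /(ex_top P) [k sk] /(ex_top P) [l tl].
exact: is_top_neq0 (is_top_mul sk tl).
Qed.

Lemma qtorus_conj_mon (u w : T) k :
  u != 0 -> u * qmon k = w * u -> w = qcoef k w *: qmon k.
Proof.
move=> u0 E; have k0 : qmon k != 0 by rewrite monalgU_eq0 oner_neq0.
have w0 : w != 0.
  by apply: contraTneq (qtorus_mulf_neq0 u0 k0) => w0; rewrite E w0 mul0r eqxx.
(* The order is left arbitrary, so that [P] and its opposite give the highest and the lowest
   exponent of [w]; both equal [k]. *)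
have H (Q : cone) : is_top Q w k.
  have [p up] := ex_top Q u0; have [r wr] := ex_top Q w0.
  have := is_top_mul up (is_top_mon Q k (oner_neq0 K)); rewrite scale1r E.
  by move=> /is_top_uniq /(_ (is_top_mul wr up)); rewrite addrC => /addIr ->.
apply: qcoefP => l; rewrite qcoefZ qcoef_mon.
case: (eqVneq k l) => [->|kl]; first by rewrite mulr1.
rewrite mulr0; apply/eqP; apply: contraT => wl.
have [_ /(_ _ wl)] := H P; have [_ /(_ _ wl)] := H (ocone P).
rewrite eq_sym kl => /(_ isT) + /(_ isT) /cpos_asym.
by rewrite /= /ocone_pos => ->.
Qed.

End Domain.

End QuantumTorus.

(** * Commutation up to a scalar *)

Section ScalarCommutation.
Variables (K : fieldType) (A : algType K).
Implicit Types (a b : K) (u v w : A).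

Definition scomm a u v : Prop := u * v = a *: (v * u).

Lemma scommMr a b u v w : scomm a u v -> scomm b u w -> scomm (a * b) u (v * w).
Proof.
move=> uv uw; rewrite /scomm mulrA uv -scalerAl -[v * u * w]mulrA uw -scalerAr.
by rewrite scalerA mulrA.
Qed.

Lemma scommMl a b u v w : scomm a u w -> scomm b v w -> scomm (a * b) (u * v) w.
Proof.
move=> uw vw; rewrite /scomm -mulrA vw -scalerAr [u * (w * v)]mulrA uw -scalerAl scalerA.
by rewrite mulrA [b * a]mulrC.
Qed.

Lemma scommBr a u v w : scomm a u v -> scomm a u w -> scomm a u (v - w).
Proof. by move=> uv uw; rewrite /scomm mulrBr mulrBl uv uw scalerBr. Qed.

Lemma scommBl a u v w : scomm a u w -> scomm a v w -> scomm a (u - v) w.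
Proof. by move=> uv uw; rewrite /scomm mulrBr mulrBl uv uw scalerBr. Qed.

Lemma scommZr a b u v : scomm a u v -> scomm a u (b *: v).
Proof.
by move=> uv; rewrite /scomm -scalerAr uv -scalerAl !scalerA mulrC.
Qed.

Lemma scommZl a b u v : scomm a u v -> scomm a (b *: u) v.
Proof.
by move=> uv; rewrite /scomm -scalerAl uv -scalerAr !scalerA mulrC.
Qed.

Lemma scomm1r u : scomm 1 u 1.
Proof. by rewrite /scomm mulr1 mul1r scale1r. Qed.

Lemma scomm1l u : scomm 1 1 u.
Proof. by rewrite /scomm mulr1 mul1r scale1r. Qed.

Lemma scomm_sym a u v : a != 0 -> scomm a u v -> scomm a^-1 v u.
Proof. by move=> a0 uv; rewrite /scomm uv scalerA mulVf // scale1r. Qed.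

Lemma scommXr a u v n : scomm a u v -> scomm (a ^+ n) u (v ^+ n).
Proof.
move=> uv; elim: n => [|n IH]; first exact: scomm1r.
by rewrite !exprS; apply: scommMr.
Qed.

(** The factors before the [k]-th are passed one at a time, each at the cost of a scalar; those
    after it are never met. *)
Lemma mul_prod_scomm n (g : A) (F : 'I_n -> A) k :
  (forall i, i != k -> exists a, scomm a g (F i)) ->
  exists a, g * \prod_i F i = a *: \prod_i (if i == k then g * F i else F i).
Proof.
move=> gF; have := mem_index_enum k; have := index_enum_uniq 'I_n.
elim: (index_enum _) => // j r IH /= /andP [jr ur]; rewrite inE !big_cons.
case: (eqVneq j k) jr => [-> kr _|jk _].
  exists 1; rewrite scale1r mulrA; congr (_ * _).
  rewrite big_seq_cond [RHS]big_seq_cond; apply: eq_bigr => i /andP [ir _].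
  by case: eqP ir => // ->; rewrite (negPf kr).
move=> /= /(IH ur) [a E]; have [b gj] := gF _ jk.
by exists (b * a); rewrite mulrA gj -scalerAl -mulrA E -scalerAr scalerA.
Qed.

Lemma prod_mul_scomm n (g : A) (F : 'I_n -> A) k :
  (forall i, i != k -> exists a, scomm a g (F i)) ->
  exists a, \prod_i (if i == k then F i * g else F i) = a *: ((\prod_i F i) * g).
Proof.
move=> gF.
(* The extra factor makes the claim uniform in [r]: when [k] is absent from [r], [g] is supplied at
   the right end by hand. *)
suff H r : uniq r -> exists a, \prod_(i <- r) (if i == k then F i * g else F i) *
    (if k \in r then 1 else g) = a *: ((\prod_(i <- r) F i) * g).
  have [a E] := H _ (index_enum_uniq 'I_n).
  by exists a; rewrite -E mem_index_enum mulr1.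
elim: r => [|j r IH] /=; first by exists 1; rewrite !big_nil mul1r scale1r.
move=> /andP [jr /IH [a E]]; rewrite inE !big_cons.
case: (eqVneq j k) jr => [-> kr|jk _]; last first.
  by exists a; rewrite -!mulrA E -scalerAr.
have -> : \prod_(j <- r) (if j == k then F j * g else F j) = \prod_(j <- r) F j.
  rewrite big_seq_cond [RHS]big_seq_cond; apply: eq_bigr => i /andP [ir _].
  by case: eqP ir => // ->; rewrite (negPf kr).
suff [b Eb] : exists b, scomm b g (\prod_(j <- r) F j).
  by exists b; rewrite mulr1 -mulrA Eb -scalerAr mulrA.
elim: r kr {IH E} => [|i r IH]; first by exists 1; rewrite big_nil; apply: scomm1r.
rewrite inE => /norP [ki /IH [b E]]; rewrite big_cons.
have [d di] : exists d, scomm d g (F i) by apply: gF; rewrite eq_sym.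
by exists (d * b); apply: scommMr.
Qed.

Lemma prod_update_linear n (F : 'I_n -> A) k a b u v :
  \prod_i (if i == k then a *: u + b *: v else F i) =
  a *: \prod_i (if i == k then u else F i) + b *: \prod_i (if i == k then v else F i).
Proof.
have := mem_index_enum k; have := index_enum_uniq 'I_n.
elim: (index_enum _) => // j r IH /= /andP [jr ur]; rewrite inE !big_cons.
case: (eqVneq j k) jr => [-> kr _|jk _]; last first.
  move=> /= /(IH ur) ->.
  by rewrite mulrDr -!scalerAr.
have E w : \prod_(j <- r) (if j == k then w else F j) = \prod_(j <- r) F j.
  rewrite big_seq_cond [RHS]big_seq_cond; apply: eq_bigr => i /andP [ir _].
  by case: eqP ir => // ->; rewrite (negPf kr).
by rewrite !E mulrDl -!scalerAl.
Qed.

End ScalarCommutation.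

(** * The lexicographic order on exponents *)

Section LexCone.
Variable n : nat.
Local Notation Zn := {ffun 'I_n -> int}.
Implicit Types k l : Zn.

Definition lexpos k : bool :=
  [exists i, (0 < k i) && [forall j : 'I_n, (j < i)%N ==> (k j == 0)]].

Lemma lexposP k : reflect
  (exists2 i, 0 < k i & forall j : 'I_n, (j < i)%N -> k j = 0) (lexpos k).
Proof.
apply: (iffP existsP) => [[i /andP [ki /forallP H]]|[i ki H]]; exists i => //.
  by move=> j ji; apply/eqP; have := H j; rewrite ji.
by rewrite ki; apply/forallP => j; apply/implyP => /H ->.
Qed.

Lemma lexpos0 : ~~ lexpos 0.
Proof. by apply/lexposP => -[i]; rewrite ffunE ltxx. Qed.

Lemma lexposD k l : lexpos k -> lexpos l -> lexpos (k + l).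
Proof.
move=> /lexposP [i ki Hi] /lexposP [j lj Hj]; apply/lexposP.
case: (ltngtP i j) => [ij|ji|/val_inj ij].
- exists i => [|p pi]; rewrite ffunE; first by rewrite Hj // addr0.
  by rewrite Hi // Hj // (ltn_trans pi).
- exists j => [|p pi]; rewrite ffunE; first by rewrite Hi // add0r.
  by rewrite Hj // Hi // (ltn_trans pi).
exists i => [|p pi]; rewrite ffunE; first by rewrite addr_gt0 // ij.
by rewrite Hi // Hj // -ij.
Qed.

Lemma lexpos_total k : k != 0 -> lexpos k || lexpos (- k).
Proof.
move=> k0; have [i0 ki0] : exists i, k i != 0.
  apply/existsP; apply: contraR k0 => /existsPn H; apply/eqP/ffunP => i.
  by rewrite ffunE; apply/eqP/negPn/H.
case: (@arg_minnP _ i0 (fun i => k i != 0) (@nat_of_ord n) ki0) => i ki Hi.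
have H (j : 'I_n) : (j < i)%N -> k j = 0.
  by move=> ji; apply/eqP; apply: contraLR ji => /Hi; rewrite -leqNgt.
have [ki_lt|ki_gt|ki0'] := ltgtP (k i) 0.
- apply/orP; right; apply/lexposP; exists i => [|j /H kj]; rewrite ffunE ?oppr_gt0 //.
  by rewrite kj oppr0.
- by apply/orP; left; apply/lexposP; exists i.
- by rewrite ki0' eqxx in ki.
Qed.

Definition lexpos2 (k : Zn * Zn) : bool :=
  lexpos k.1 || (k.1 == 0) && lexpos k.2.

Lemma lexpos2_0 : ~~ lexpos2 0.
Proof. by rewrite /lexpos2 /= eqxx (negPf lexpos0). Qed.

Lemma lexpos2D (k l : Zn * Zn) : lexpos2 k -> lexpos2 l -> lexpos2 (k + l).
Proof.
case: k l => [a d] [b e]; rewrite /lexpos2 /=.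
move=> /orP [Ha|/andP [/eqP -> Hd]] /orP [Hb|/andP [/eqP -> He]].
- by rewrite lexposD.
- by rewrite addr0 Ha.
- by rewrite add0r Hb.
by rewrite add0r eqxx lexposD // orbT.
Qed.

Lemma lexpos2_total (k : Zn * Zn) : k != 0 -> lexpos2 k || lexpos2 (- k).
Proof.
case: k => [a d]; rewrite /lexpos2 /= oppr_eq0.
case: (eqVneq a 0) => [->|/lexpos_total /orP [->|->]]; rewrite ?orbT // oppr0 => h.
have /lexpos_total : d != 0 by apply: contraNneq h => ->.
by rewrite (negPf lexpos0) /= => /orP [] ->; rewrite ?orbT.
Qed.

Definition lexcone : cone (Zn * Zn)%type :=
  Cone lexpos2_0 lexpos2D lexpos2_total.

End LexCone.

Lemma expfz_eq1 (K : fieldType) (a : K) (e : int) :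
  not_root_of_unity a -> a ^ e = 1 -> e = 0.
Proof.
case: e => [[|k]|k] // a1 E; first by have := a1 k.+1 isT; rewrite -E eqxx.
by have := a1 k.+1 isT; rewrite -[a ^+ _]invrK -[a ^- _]/(a ^ Negz k) E invr1 eqxx.
Qed.

Lemma expfz_inj (K : fieldType) (a : K) (d e : int) :
  a != 0 -> not_root_of_unity a -> a ^ d = a ^ e -> d = e.
Proof.
move=> a0 a1 E; apply/eqP; rewrite -subr_eq0; apply/eqP/(expfz_eq1 a1).
by rewrite expfzDr // E -expfzDr // subrr expr0z.
Qed.

Definition unitf n (i : 'I_n) : {ffun 'I_n -> int} := [ffun j => (j == i)%:Z].

(** * The quantum torus and the images of the generators *)

Section Model.
Variables (K : fieldType) (n : nat) (q : 'I_n -> K) (L : 'I_n -> 'I_n -> K).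
Hypothesis hqL : qweyl_data q L.
Local Notation Zn := {ffun 'I_n -> int}.

Let q0 i : q i != 0. Proof. by case: hqL. Qed.
Let L0 i j : L i j != 0. Proof. by case: hqL. Qed.
Let LV i j : L i j = (L j i)^-1. Proof. by case: hqL. Qed.

Definition upperL (i j : 'I_n) : K := if (i < j)%N then L i j else 1.

Lemma upperL_neq0 i j : upperL i j != 0.
Proof. by rewrite /upperL; case: ifP => // _; apply: oner_neq0. Qed.

(** The scalar produced by reordering when the basis element of exponent (a, d) is read as Z^a
    X_n^(d_n) ... X_1^(d_1): X_i passes Z_i at the cost of q_i, and X_i passes X_j with i < j at the
    cost of L_ij. Decreasing indices are why only the upper part of [L] appears. *)
Definition mchar (k l : Zn * Zn) : K :=
  (\prod_i q i ^ (k.2 i * l.1 i)) * \prod_i \prod_j upperL i j ^ (k.2 i * l.2 j).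

Lemma mcharDl k l p : mchar (k + l) p = mchar k p * mchar l p.
Proof.
rewrite /mchar mulrACA; congr (_ * _); rewrite -big_split /=; apply: eq_bigr => i _.
  by rewrite ffunE mulrDl expfzDr.
rewrite -big_split /=; apply: eq_bigr => j _.
by rewrite ffunE mulrDl expfzDr // upperL_neq0.
Qed.

Lemma mcharDr k l p : mchar k (l + p) = mchar k l * mchar k p.
Proof.
rewrite /mchar mulrACA; congr (_ * _); rewrite -big_split /=; apply: eq_bigr => i _.
  by rewrite ffunE mulrDr expfzDr.
rewrite -big_split /=; apply: eq_bigr => j _.
by rewrite ffunE mulrDr expfzDr // upperL_neq0.
Qed.

Lemma mchar_neq0 k l : mchar k l != 0.
Proof.
rewrite mulf_neq0 //; apply/prodf_neq0 => i _; first exact: expfz_neq0.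
by apply/prodf_neq0 => j _; apply/expfz_neq0/upperL_neq0.
Qed.

Definition mbichar : bichar K (Zn * Zn)%type := Bichar mcharDl mcharDr mchar_neq0.
Local Notation c := mbichar.

Definition ez (i : 'I_n) : Zn * Zn := (unitf i, 0).
Definition ex (i : 'I_n) : Zn * Zn := (0, unitf i).

Lemma prod_unitf (f : 'I_n -> K) (g : 'I_n -> int) i :
  \prod_j f j ^ (g j * unitf i j) = f i ^ g i.
Proof.
rewrite (bigD1 i) //= ffunE eqxx mulr1 big1 ?mulr1 // => j /negPf ji.
by rewrite ffunE ji mulr0 expr0z.
Qed.

Lemma mchar_ezl i k : c (ez i) k = 1.
Proof.
rewrite /= /mchar /=; rewrite !big1 ?mulr1 // => j _; last first.
  by rewrite ffunE mul0r expr0z.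
by rewrite big1 // => l _; rewrite ffunE mul0r expr0z.
Qed.

Lemma mchar_ezr i k : c k (ez i) = q i ^ k.2 i.
Proof.
rewrite /= /mchar /= prod_unitf big1 ?mulr1 // => j _.
by rewrite big1 // => l _; rewrite ffunE mulr0 expr0z.
Qed.

Lemma mchar_exl i k : c (ex i) k = q i ^ k.1 i * \prod_j upperL i j ^ k.2 j.
Proof.
rewrite /= /mchar /=; under eq_bigr do rewrite mulrC.
rewrite prod_unitf; congr (_ * _).
rewrite (bigD1 i) //= [X in _ * X]big1 ?mulr1.
  by apply: eq_bigr => j _; rewrite ffunE eqxx mul1r.
by move=> j /negPf ji; rewrite big1 // => l _; rewrite ffunE ji mul0r expr0z.
Qed.

Lemma mchar_exr i k : c k (ex i) = \prod_j upperL j i ^ k.2 j.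
Proof.
rewrite /= /mchar /= big1 ?mul1r.
  by apply: eq_bigr => j _; rewrite prod_unitf.
by move=> j _; rewrite ffunE mulr0 expr0z.
Qed.

Lemma mchar_exx i j : c (ex i) (ex j) = upperL i j.
Proof.
rewrite mchar_exl ffunE expr0z mul1r.
by under eq_bigr do rewrite -[X in _ ^ X]mul1r; rewrite (prod_unitf _ (fun=> 1)) expr1z.
Qed.

Lemma mcharNr k l : c k (- l) = (c k l)^-1.
Proof.
apply: (mulfI (bchar_neq0 c k l)).
by rewrite -bcharDr subrr bchar0r divff // bchar_neq0.
Qed.

Lemma mcharNl k l : c (- k) l = (c k l)^-1.
Proof.
apply: (mulfI (bchar_neq0 c k l)).
by rewrite -bcharDl subrr bchar0l divff // bchar_neq0.
Qed.

Local Notation T := (qtorus c).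

Definition mX (i : 'I_n) : T := qmon c (ex i).
Definition mZ (i : 'I_n) : T := qmon c (ez i).
Definition mW (i : 'I_n) : T := qmon c (- ex i).
(** The relation x_i y_i - q_i y_i x_i = 1 amounts to z_i = 1 + (q_i - 1) y_i x_i; this is its
    solution for y_i once x_i is invertible. *)
Definition mY (i : 'I_n) : T := (q i - 1)^-1 *: ((mZ i - 1) * mW i).

Lemma scomm_qmon k l a : a * c l k = c k l -> scomm a (qmon c k) (qmon c l).
Proof. by move=> E; rewrite /scomm (qmonM c k l) (qmonM c l k) scalerA E (addrC l k). Qed.

Lemma mX_mZ i j : scomm (q i ^+ (i == j)) (mX i) (mZ j).
Proof.
apply: scomm_qmon; rewrite mchar_ezl mchar_ezr mulr1 ffunE eq_sym.
by case: eqVneq => [->|].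
Qed.

Lemma mX_mW i : mX i * mW i = 1.
Proof.
by rewrite qmonM mcharNr mchar_exx /upperL ltnn invr1 scale1r subrr qmon0.
Qed.

Lemma mW_mX i : mW i * mX i = 1.
Proof.
by rewrite qmonM mcharNl mchar_exx /upperL ltnn invr1 scale1r addNr qmon0.
Qed.

Hypothesis q1 : forall i, q i != 1.

Lemma mY_mX i : mY i * mX i = (q i - 1)^-1 *: (mZ i - 1).
Proof. by rewrite -scalerAl -mulrA mW_mX mulr1. Qed.

Lemma mX_mY i : mX i * mY i = (q i - 1)^-1 *: (q i *: mZ i - 1).
Proof.
rewrite -scalerAr; congr (_ *: _); rewrite mulrA mulrBr (mX_mZ i i) eqxx expr1 mulr1.
by rewrite -{2}[mX i]mul1r scalerAl -mulrBl -mulrA mX_mW mulr1.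
Qed.

Lemma model_rel : qweyl_rel q L mX mY.
Proof.
(* For distinct indices the factors Z_j - 1 commute with everything in sight, so every scalar in the
   mixed relations comes from the powers of X_i and X_j. *)
have Z1 i j k : i != j -> k = ex i \/ k = - ex i -> scomm 1 (qmon c k) (mZ j - 1).
  move=> /negPf ij ke; apply: scommBr (scomm1r _); apply: scomm_qmon.
  rewrite mchar_ezl mchar_ezr mul1r.
  by case: ke => -> /=; rewrite !ffunE eq_sym ij ?oppr0 expr0z.
have ZZ i j : scomm 1 (mZ i - 1) (mZ j - 1).
  apply: scommBr (scomm1r _); apply: scommBl (scomm1l _); apply: scomm_qmon.
  by rewrite !mchar_ezl mulr1.
have Z1' i j k : i != j -> k = ex i \/ k = - ex i -> scomm 1 (mZ j - 1) (qmon c k).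
  by move=> ij ke; have := scomm_sym (oner_neq0 _) (Z1 _ _ _ ij ke); rewrite invr1.
split=> [i j ij|i]; last first.
  rewrite (mX_mY i) (mY_mX i) scalerA [q i * _]mulrC -scalerA -scalerBr.
  rewrite [q i *: (_ - _)]scalerBr opprB [X in _ *: X]addrC subrKA.
  have -> : q i *: 1 - 1 = (q i - 1) *: 1 :> T by rewrite scalerBl scale1r.
  rewrite scalerA mulVf ?scale1r //.
  by rewrite subr_eq0.
have ij' : i != j by rewrite neq_ltn ij.
have ji' : j != i by rewrite eq_sym.
have nji : (j < i)%N = false by apply/negbTE; rewrite -leqNgt ltnW.
have W k : - ex k = ex k \/ - ex k = - ex k by right.
have X k : ex k = ex k \/ ex k = - ex k by left.
split.
- by apply: scomm_qmon; rewrite !mchar_exx /upperL ij nji mulr1.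
- apply/scommZl/scommZr; have -> : L j i = 1 * 1 * (1 * L j i) by rewrite !mul1r.
  apply: scommMl; apply: scommMr;
    [exact: ZZ | exact: (Z1' _ _ _ ij' (W i)) | exact: (Z1 _ _ _ ji' (W j)) |].
  apply: scomm_qmon; rewrite !mcharNl !mcharNr !mchar_exx /upperL ij nji.
  by rewrite !invrK LV mulVf.
- apply/scommZr; have -> : L j i = 1 * L j i by rewrite !mul1r.
  apply: scommMr; first exact: (Z1 _ _ _ ij' (X i)).
  apply: scomm_qmon; rewrite !mcharNl !mcharNr !mchar_exx /upperL ij nji.
  by rewrite invr1 mulr1 LV.
- apply/scommZr; have -> : L i j = 1 * L i j by rewrite !mul1r.
  apply: scommMr; first exact: (Z1 _ _ _ ji' (X j)).
  apply: scomm_qmon; rewrite !mcharNl !mcharNr !mchar_exx /upperL ij nji.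
  by rewrite divff // invr1.
Qed.

End Model.

(** * Induction on generators from the universal property *)

Section GeneratedSubalgebra.
Variables (K : fieldType) (A : algType K) (S : A -> Prop).

(** The conditions on [S] sit inside the predicate, so that it is a subalgebra for every [S] and the
    structure instances need no hypothesis. When the conditions hold, its members are the elements
    whose left multiplication preserves [S]. *)
Definition stabilizer : {pred A} :=
  fun a => `[< S 1 -> (forall b u v, S u -> S v -> S (b *: u + v)) ->
               forall u, S u -> S (a * u) >].

Lemma stabilizer_subalg : subalg_closed stabilizer.
Proof.
split.
- by apply/asboolP => _ _ u; rewrite mul1r.
- move=> a u v /asboolP Hu /asboolP Hv; apply/asboolP => S1 Sl w Sw.
  by rewrite mulrDl -scalerAl; apply: (Sl); [apply: Hu | apply: Hv].
move=> u v /asboolP Hu /asboolP Hv; apply/asboolP => S1 Sl w Sw.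
by rewrite -mulrA; apply: Hu => //; apply: Hv.
Qed.
HB.instance Definition _ := GRing.isSubalgClosed.Build K A stabilizer stabilizer_subalg.

Record stab_alg := StabAlg { stab_val : A; _ : stab_val \in stabilizer }.
HB.instance Definition _ := [isSub for stab_val].
HB.instance Definition _ := [Choice of stab_alg by <:].
HB.instance Definition _ := [SubChoice_isSubAlgebra of stab_alg by <:].

Lemma stab_val_linear : linear stab_val. Proof. by []. Qed.
HB.instance Definition _ :=
  GRing.isLinear.Build K stab_alg A *:%R stab_val stab_val_linear.
Lemma stab_val_monoid : monoid_morphism stab_val. Proof. by []. Qed.
HB.instance Definition _ :=
  GRing.isMonoidMorphism.Build stab_alg A stab_val stab_val_monoid.

End GeneratedSubalgebra.

Section Presented.
Variables (K : fieldType) (n : nat) (q : 'I_n -> K) (L : 'I_n -> 'I_n -> K).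
Variables (A : algType K) (x y : 'I_n -> A).
Hypothesis hA : is_qweyl q L x y.

Lemma qweyl_hom_uniq (B : algType K) (f g : {lrmorphism A -> B}) :
  (forall i, f (x i) = g (x i) /\ f (y i) = g (y i)) -> f =1 g.
Proof.
move=> fg; have [[R1 R2] U] := hA.
have [|h [_ Hh]] := U B (fun i => g (x i)) (fun i => g (y i)).
  split=> [i j /R1 [xx yy xy yx]|i].
    by split; rewrite -!rmorphM -linearZ_LR; congr (g _).
  by rewrite -!rmorphM -linearZ_LR -rmorphB R2 rmorph1.
by move=> u; rewrite (Hh f) // (Hh g).
Qed.

(** The generators lie in the stabilizer of [S], so the universal property maps the algebra into it.
    Followed by the inclusion, this map fixes the generators, hence is the identity by uniqueness;
    every element stabilizes [S], and applying it to 1 gives the claim. *)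
Lemma qweyl_ind (S : A -> Prop) :
  S 1 -> (forall a u v, S u -> S v -> S (a *: u + v)) ->
  (forall i u, S u -> S (x i * u)) -> (forall i u, S u -> S (y i * u)) ->
  forall u, S u.
Proof.
move=> S1 Sl Sx Sy.
have Qx i : x i \in stabilizer S by apply/asboolP => _ _; apply: Sx.
have Qy i : y i \in stabilizer S by apply/asboolP => _ _; apply: Sy.
have [[R1 R2] U] := hA.
have [|f [Hf _]] := U (stab_alg S) (fun i => StabAlg (Qx i)) (fun i => StabAlg (Qy i)).
  split=> [i j /R1 [xx yy xy yx]|i].
    by split; apply: val_inj; rewrite linearZ_LR !rmorphM /=.
  by apply: val_inj; apply: R2.
pose g : {lrmorphism A -> A} := @stab_val K A S \o f.
have gE : g =1 (idfun : {lrmorphism A -> A}).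
  by apply: qweyl_hom_uniq => i; rewrite /g /=; have [-> ->] := Hf i.
move=> u; rewrite -[u]gE /g /=.
by have /asboolP /(_ S1 Sl _ S1) := valP (f u); rewrite mulr1.
Qed.

End Presented.

(** * Commutation rules for the z_i *)

Definition qz (R : ringType) n (x y : 'I_n -> R) i := x i * y i - y i * x i.

Section Relations.
Variables (K : fieldType) (n : nat) (q : 'I_n -> K) (L : 'I_n -> 'I_n -> K).
Variables (A : algType K) (x y : 'I_n -> A).
Hypotheses (hqL : qweyl_data q L) (hr : qweyl_rel q L x y).
Local Notation z := (qz x y).

Let L0 i j : L i j != 0. Proof. by case: hqL. Qed.
Let LV i j : (L i j)^-1 = L j i. Proof. by case: hqL => _ _ _ -> _; rewrite invrK. Qed.

Lemma rel_xx i j : i != j -> scomm (L i j) (x i) (x j).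
Proof.
rewrite neq_ltn => /orP [] /(proj1 hr) [xx _ _ _] //.
by rewrite -LV; apply: scomm_sym.
Qed.

Lemma rel_yy i j : i != j -> scomm (L i j) (y i) (y j).
Proof.
rewrite neq_ltn => /orP [] /(proj1 hr) [_ yy _ _] //.
by rewrite -LV; apply: scomm_sym.
Qed.

Lemma rel_xy i j : i != j -> scomm (L j i) (x i) (y j).
Proof. by rewrite neq_ltn => /orP [] /(proj1 hr) [_ _ xy yx]. Qed.

Lemma rel_yx i j : i != j -> scomm (L j i) (y i) (x j).
Proof. by move=> ij; rewrite -LV; apply: scomm_sym => //; apply: rel_xy; rewrite eq_sym. Qed.

Lemma mulLV i j : L i j * L j i = 1.
Proof. by rewrite -LV mulVf. Qed.

(** In both terms of z_i the scalars from x_i and from y_i are inverse to each other. *)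
Lemma rel_zx i j : i != j -> scomm 1 (z i) (x j).
Proof.
move=> ij; rewrite -(mulLV i j); apply: scommBl; last rewrite mulrC.
  by apply: scommMl; [apply: rel_xx | apply: rel_yx].
by apply: scommMl; [apply: rel_yx | apply: rel_xx].
Qed.

Lemma rel_zy i j : i != j -> scomm 1 (z i) (y j).
Proof.
move=> ij; rewrite -(mulLV j i); apply: scommBl; last rewrite mulrC.
  by apply: scommMl; [apply: rel_xy | apply: rel_yy].
by apply: scommMl; [apply: rel_yy | apply: rel_xy].
Qed.

Lemma rel_xyE i : x i * y i = 1 + q i *: (y i * x i).
Proof. by rewrite -(proj2 hr i) subrK. Qed.

Lemma qzE i : z i = 1 + (q i - 1) *: (y i * x i).
Proof. by rewrite /qz rel_xyE -addrA scalerBl scale1r. Qed.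

Lemma rel_xz i : scomm (q i) (x i) (z i).
Proof.
rewrite /scomm qzE mulrDr mulrDl mulr1 mul1r -scalerAr -scalerAl mulrA rel_xyE.
rewrite mulrDl mul1r -scalerAl !scalerDr addrA; congr (_ + _).
  by rewrite -{1}[x i]scale1r -scalerDl subrKC.
by rewrite !scalerA mulrC.
Qed.

Lemma rel_zyi i : scomm (q i) (z i) (y i).
Proof.
rewrite /scomm qzE mulrDr mulrDl mulr1 mul1r -scalerAr -scalerAl -mulrA rel_xyE.
rewrite mulrDr mulr1 -scalerAr !scalerDr addrA; congr (_ + _).
  by rewrite -{1}[y i]scale1r -scalerDl subrKC.
by rewrite !scalerA mulrC.
Qed.

Hypothesis q1 : forall i, q i != 1.
Let q10 i : q i - 1 != 0. Proof. by rewrite subr_eq0. Qed.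

Lemma rel_yxz i : y i * x i = (q i - 1)^-1 *: z i - (q i - 1)^-1 *: 1.
Proof. by rewrite qzE -scalerBr [1 + _]addrC addrK scalerA mulVf // scale1r. Qed.

Lemma rel_xyz i : x i * y i = (q i / (q i - 1)) *: z i - (q i - 1)^-1 *: 1.
Proof.
rewrite rel_xyE rel_yxz scalerBr !scalerA addrCA; congr (_ + _).
rewrite -scaleNr -[X in X + _]scale1r -scalerDl -scaleNr; congr (_ *: _).
by field; apply: q10.
Qed.

End Relations.

(** * Spanning by ordered monomials *)

Section Spanning.
Variables (K : fieldType) (n : nat) (q : 'I_n -> K) (L : 'I_n -> 'I_n -> K).
Variables (A : algType K) (x y : 'I_n -> A).
Hypotheses (hqL : qweyl_data q L) (hA : is_qweyl q L x y).
Hypothesis q1 : forall i, q i != 1.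
Local Notation z := (qz x y).
Local Notation idx := ({ffun 'I_n -> nat} * {ffun 'I_n -> int})%type.

Let hr : qweyl_rel q L x y. Proof. by case: hA. Qed.
Let q0 i : q i != 0. Proof. by case: hqL. Qed.

(** Negative powers of x_i are replaced by powers of y_i. Since x_i y_i and y_i x_i are affine in
    z_i, multiplying by x_i or y_i shifts [t] by one and at worst adds one factor z_i. [Negz k] is
    -(k + 1), hence the exponent [k.+1]. *)
Definition xpow i (t : int) : A :=
  match t with Posz k => x i ^+ k | Negz k => y i ^+ k.+1 end.

Definition wmon i (s : nat) (t : int) : A := z i ^+ s * xpow i t.

Definition pbw (h : idx) : A := \prod_i wmon i (h.1 i) (h.2 i).

Lemma x_xpow i t : exists a b,
  x i * xpow i t = a *: (z i * xpow i (t + 1)) + b *: xpow i (t + 1).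
Proof.
case: t => [k|[|k]].
- exists 0, 1; rewrite scale0r add0r scale1r.
  have -> : Posz k + 1 = Posz k.+1 by lia.
  by rewrite /= exprS.
- exists (q i / (q i - 1)), (- (q i - 1)^-1).
  have -> : Negz 0 + 1 = Posz 0 by [].
  rewrite /= expr1 expr0 mulr1.
  by rewrite (rel_xyz hr q1) scaleNr.
- exists (q i / (q i - 1)), (- (q i - 1)^-1).
  have -> : Negz k.+1 + 1 = Negz k by lia.
  rewrite /= exprS mulrA (rel_xyz hr q1) mulrBl -!scalerAl mul1r.
  by rewrite scaleNr.
Qed.

Lemma y_xpow i t : exists a b,
  y i * xpow i t = a *: (z i * xpow i (t - 1)) + b *: xpow i (t - 1).
Proof.
case: t => [[|k]|k].
- by exists 0, 1; rewrite scale0r add0r scale1r /= expr0 mulr1.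
- exists (q i - 1)^-1, (- (q i - 1)^-1).
  have -> : Posz k.+1 - 1 = Posz k by lia.
  rewrite /= exprS mulrA (rel_yxz hr q1) mulrBl -!scalerAl mul1r.
  by rewrite scaleNr.
- exists 0, 1; rewrite scale0r add0r scale1r.
  have -> : Negz k - 1 = Negz k.+1 by lia.
  by rewrite /= [RHS]exprS.
Qed.

Lemma x_wmon i s t : exists a b,
  x i * wmon i s t = a *: wmon i s.+1 (t + 1) + b *: wmon i s (t + 1).
Proof.
have [a [b E]] := x_xpow i t; exists (q i ^+ s * a), (q i ^+ s * b).
rewrite /wmon mulrA (scommXr s (rel_xz hr i)) -scalerAl -mulrA E mulrDr.
by rewrite -!scalerAr scalerDr !scalerA exprSr !mulrA.
Qed.

Lemma y_wmon i s t : exists a b,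
  y i * wmon i s t = a *: wmon i s.+1 (t - 1) + b *: wmon i s (t - 1).
Proof.
have [a [b E]] := y_xpow i t; exists ((q i)^-1 ^+ s * a), ((q i)^-1 ^+ s * b).
rewrite /wmon mulrA (scommXr s (scomm_sym (q0 i) (rel_zyi hr i))) -scalerAl.
by rewrite -mulrA E mulrDr -!scalerAr scalerDr !scalerA exprSr !mulrA.
Qed.

Lemma x_wmon_scomm i k s t : i != k -> exists a, scomm a (x k) (wmon i s t).
Proof.
move=> ik; have xz := scomm_sym (oner_neq0 K) (rel_zx hqL hr ik).
have ki : k != i by rewrite eq_sym.
case: t => t; eexists; apply: scommMr; try exact: scommXr xz.
  exact: scommXr (rel_xx hqL hr ki).
exact: scommXr (rel_xy hr ki).
Qed.

Lemma y_wmon_scomm i k s t : i != k -> exists a, scomm a (y k) (wmon i s t).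
Proof.
move=> ik; have xz := scomm_sym (oner_neq0 K) (rel_zy hqL hr ik).
have ki : k != i by rewrite eq_sym.
case: t => t; eexists; apply: scommMr; try exact: scommXr xz.
  exact: scommXr (rel_yx hqL hr ki).
exact: scommXr (rel_yy hqL hr ki).
Qed.

(** The common part of left multiplication by x_k and by y_k: the generator travels to the [k]-th
    factor, which alone splits into two terms. *)
Lemma pbw_step k (h : idx) (u : A) t :
  (forall i s t, i != k -> exists a, scomm a u (wmon i s t)) ->
  (exists a b, u * wmon k (h.1 k) (h.2 k) =
     a *: wmon k (h.1 k).+1 t + b *: wmon k (h.1 k) t) ->
  exists g, u * pbw h = lext pbw g.
Proof.
move=> uw [a [b E]].
have [|d ->] := mul_prod_scomm (g := u) (F := fun i => wmon i (h.1 i) (h.2 i)) (k := k).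
  by move=> i ik; apply: uw.
pose upd s : idx := ([ffun i => if i == k then s else h.1 i],
                     [ffun i => if i == k then t else h.2 i]).
exists (<< d * a *g upd (h.1 k).+1 >> + << d * b *g upd (h.1 k) >>).
rewrite lextU2 -!scalerA -scalerDr; congr (_ *: _).
transitivity (\prod_i (if i == k then a *: wmon k (h.1 k).+1 t + b *: wmon k (h.1 k) t
                       else wmon i (h.1 i) (h.2 i))).
  by apply: eq_bigr => i _; case: eqP => // ->.
rewrite prod_update_linear; congr (_ *: _ + _ *: _); apply: eq_bigr => i _.
  by rewrite /= !ffunE; case: eqP => // ->.
by rewrite /= !ffunE; case: eqP => // ->.
Qed.

Lemma pbw_span u : exists g, u = lext pbw g.
Proof.
elim/(qweyl_ind hA): u => [|a u v [g ->] [h ->]|k u|k u].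
- exists << (0 : idx) >>; rewrite lextU scale1r /pbw big1 // => i _.
  by rewrite !ffunE /wmon expr0 mul1r.
- by exists (a *: g + h); rewrite lextD lextZ.
- move=> [g ->]; rewrite mulr_sumr; apply: (big_ind (fun u => exists g, u = lext pbw g)).
  + by exists 0; rewrite linear0.
  + by move=> _ _ [g1 ->] [g2 ->]; exists (g1 + g2); rewrite lextD.
  move=> h _; have [||g' E] := pbw_step (k := k) (h := h) (u := x k) (t := h.2 k + 1).
  + by move=> i s t; apply: x_wmon_scomm.
  + exact: x_wmon.
  by exists (g@_h *: g'); rewrite lextZ -E scalerAr.
move=> [g ->]; rewrite mulr_sumr; apply: (big_ind (fun u => exists g, u = lext pbw g)).
+ by exists 0; rewrite linear0.
+ by move=> _ _ [g1 ->] [g2 ->]; exists (g1 + g2); rewrite lextD.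
move=> h _; have [||g' E] := pbw_step (k := k) (h := h) (u := y k) (t := h.2 k - 1).
+ by move=> i s t; apply: y_wmon_scomm.
+ exact: y_wmon.
by exists (g@_h *: g'); rewrite lextZ -E scalerAr.
Qed.

(** A factor [g] split off the [i]-th power is carried to the right end. This later turns degree
    information into right divisibility by a generator. *)
Lemma pbw_mulr i (h : idx) t g :
  (forall j s t, j != i -> exists a, scomm a g (wmon j s t)) ->
  xpow i (h.2 i) = xpow i t * g -> exists u, pbw h = u * g.
Proof.
move=> gw E; pose F j := wmon j (h.1 j) (if j == i then t else h.2 j).
have [|a Ea] := prod_mul_scomm (g := g) (F := F) (k := i).
  by move=> j ji; apply: gw.
exists (a *: \prod_j F j); rewrite -scalerAl -Ea; apply: eq_bigr => j _.
by rewrite /F; case: eqP => [->|//]; rewrite /wmon E mulrA.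
Qed.

End Spanning.

(** * Top exponents of powers, products and generators *)

Section TopFacts.
Variables (K : fieldType) (G : zmodType) (c : bichar K G) (P : cone G).
Implicit Types (t : qtorus c) (k : G).

Lemma is_top1 : is_top P (1 : qtorus c) 0.
Proof. by rewrite -qmon0 -[qmon c 0]scale1r; apply/is_top_mon/oner_neq0. Qed.

Lemma is_topZ a t k : a != 0 -> is_top P t k -> is_top P (a *: t) k.
Proof.
move=> a0 [tk Ht]; split; first by rewrite qcoefZ mulf_neq0.
by move=> l; rewrite qcoefZ mulf_eq0 negb_or => /andP [_]; apply: Ht.
Qed.

Lemma is_top_exp t k m : is_top P t k -> is_top P (t ^+ m) (k *+ m).
Proof.
move=> tk; elim: m => [|m IH]; first exact: is_top1.
by rewrite exprS mulrS; apply: is_top_mul.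
Qed.

Lemma is_top_prod (I : finType) (F : I -> qtorus c) (k : I -> G) :
  (forall i, is_top P (F i) (k i)) -> is_top P (\prod_i F i) (\sum_i k i).
Proof.
move=> Fk; elim: (index_enum I) => [|i r IH]; first by rewrite !big_nil; apply: is_top1.
by rewrite !big_cons; apply: is_top_mul.
Qed.

End TopFacts.

Section ModelTop.
Variables (K : fieldType) (n : nat) (q : 'I_n -> K) (L : 'I_n -> 'I_n -> K).
Hypothesis hqL : qweyl_data q L.
Hypothesis q1 : forall i, q i != 1.
Local Notation Zn := {ffun 'I_n -> int}.
Local Notation Q := (ocone (lexcone n)).
Local Notation mX := (mX hqL).
Local Notation mY := (mY hqL).
Local Notation mZ := (mZ hqL).
Local Notation mW := (mW hqL).

Definition unitz (i : 'I_n) (m : int) : Zn := [ffun j => if j == i then m else 0].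

Lemma unitfMn i s : unitf i *+ s = unitz i s%:Z.
Proof.
apply/ffunP => j; rewrite ffunMnE !ffunE.
by case: eqP => _; [rewrite -mulr_natr mul1r natz | rewrite mul0rn].
Qed.

Lemma ezMn i s : ez i *+ s = (unitz i s%:Z, 0).
Proof.
elim: s => [|s IH]; first by congr (_, _); apply/ffunP => j; rewrite !ffunE if_same.
rewrite mulrS IH; congr (_, _) => /=; last by rewrite add0r.
by apply/ffunP => j; rewrite !ffunE; case: eqP => _ //=; lia.
Qed.

Lemma exMn i s : ex i *+ s = (0, unitz i s%:Z).
Proof.
elim: s => [|s IH]; first by congr (_, _); apply/ffunP => j; rewrite !ffunE if_same.
rewrite mulrS IH; congr (_, _) => /=; first by rewrite add0r.
by apply/ffunP => j; rewrite !ffunE; case: eqP => _ //=; lia.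
Qed.

Lemma exNMn i s : (- ex i) *+ s = (0, unitz i (- s%:Z)).
Proof.
rewrite mulNrn exMn; congr (_, _) => /=; first by rewrite oppr0.
by apply/ffunP => j; rewrite !ffunE; case: eqP.
Qed.

Lemma is_top_qmon (k : Zn * Zn) : is_top Q (qmon (mbichar hqL) k) k.
Proof. by rewrite -[qmon _ k]scale1r; apply/is_top_mon/oner_neq0. Qed.

Lemma ez_neq0 (i : 'I_n) : ez i != 0.
Proof. by apply/eqP => /(congr1 fst) /= /ffunP /(_ i); rewrite !ffunE eqxx. Qed.

Lemma qcoef_mZ1 i k : qcoef k (mZ i - 1) = (ez i == k)%:R - (0 == k)%:R.
Proof. by rewrite qcoefB -qmon0 qcoef_mon qcoef_mon. Qed.

Lemma qcoef_mZ1_neq0 i k : qcoef k (mZ i - 1) != 0 -> k = ez i \/ k = 0.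
Proof.
rewrite qcoef_mZ1; case: (ez i =P k) => [<-|_]; first by left.
by case: (0 =P k) => [<-|_]; [right | rewrite subrr eqxx].
Qed.

(** In the reversed order the constant term beats Z_i. Hence y_i has top [- ex i], exactly that of
    an inverse of x_i, and the tops of ordered monomials are their exponents without correction. *)
Lemma is_top_mZ1 i : is_top Q (mZ i - 1) 0.
Proof.
split; first by rewrite qcoef_mZ1 (negPf (ez_neq0 i)) eqxx sub0r oppr_eq0 oner_eq0.
move=> l /qcoef_mZ1_neq0 [->|->]; last by rewrite eqxx.
move=> _; rewrite /= /ocone_pos sub0r opprK /= /lexpos2 /=; apply/orP; left.
apply/lexposP; exists i => [|j ji]; rewrite ffunE ?eqxx //.
by case: eqP ji => // ->; rewrite ltnn.
Qed.

Lemma is_top_mY i : is_top Q (mY i) (- ex i).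
Proof.
apply: is_topZ; first by rewrite invr_eq0 subr_eq0.
by rewrite -[- ex i]add0r; apply: is_top_mul (is_top_mZ1 i) (is_top_qmon _).
Qed.

Lemma qcoef_mY_neq0 i k : qcoef k (mY i) != 0 -> k = ez i - ex i \/ k = - ex i.
Proof.
rewrite qcoefZ mulf_eq0 negb_or => /andP [_ /qcoefM_neq0 [l [p [l0]]]].
rewrite qcoef_mon; case: (- ex i =P p) => [<- _ ->|]; last by rewrite eqxx.
by case: (qcoef_mZ1_neq0 l0) => ->; [left | right; rewrite add0r].
Qed.

End ModelTop.

(** * Injectivity of the embedding and the grading by X-exponents *)

Section Embedding.
Variables (K : fieldType) (n : nat) (q : 'I_n -> K) (L : 'I_n -> 'I_n -> K).
Variables (A : algType K) (x y : 'I_n -> A).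
Hypotheses (hqL : qweyl_data q L) (hA : is_qweyl q L x y).
Hypothesis q1 : forall i, q i != 1.
Local Notation z := (qz x y).
Local Notation Zn := {ffun 'I_n -> int}.
Local Notation idx := ({ffun 'I_n -> nat} * {ffun 'I_n -> int})%type.
Local Notation Q := (ocone (lexcone n)).
Local Notation T := (qtorus (mbichar hqL)).

Lemma ex_rho : exists rho : {lrmorphism A -> T},
  forall i, rho (x i) = mX hqL i /\ rho (y i) = mY hqL i.
Proof.
have [_ U] := hA; have [f [Hf _]] := U _ _ _ (model_rel hqL q1).
by exists f.
Qed.

Variable rho : {lrmorphism A -> T}.
Hypothesis hrho : forall i, rho (x i) = mX hqL i /\ rho (y i) = mY hqL i.
Let rx i : rho (x i) = mX hqL i. Proof. by case: (hrho i). Qed.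
Let ry i : rho (y i) = mY hqL i. Proof. by case: (hrho i). Qed.

Lemma rho_z i : rho (z i) = mZ hqL i.
Proof.
rewrite (qzE (proj1 hA)) linearD linearZ_LR rmorph1 rmorphM /= rx ry mY_mX.
by rewrite scalerA mulfV ?subr_eq0 // scale1r subrKC.
Qed.

Definition embed (h : idx) : Zn * Zn := ([ffun i => (h.1 i)%:Z], h.2).

Lemma embed_inj : injective embed.
Proof.
move=> [a d] [b e] [/ffunP ab ->]; congr (_, _); apply/ffunP => i.
by have := ab i; rewrite !ffunE => -[].
Qed.

Lemma is_top_rho_wmon i s t :
  is_top Q (rho (wmon x y i s t)) (unitz i s%:Z, unitz i t).
Proof.
have -> : (unitz i s%:Z, unitz i t) = ez i *+ s + (0, unitz i t).
  by rewrite ezMn; congr (_, _); rewrite /= ?addr0 ?add0r.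
rewrite rmorphM rmorphXn /= rho_z; apply: is_top_mul.
  exact/is_top_exp/is_top_qmon.
case: t => k /=; rewrite rmorphXn /= ?rx ?ry.
  by rewrite -exMn; apply/is_top_exp/is_top_qmon.
by rewrite NegzE -exNMn; apply/is_top_exp/is_top_mY.
Qed.

Lemma is_top_rho_pbw h : is_top Q (rho (pbw x y h)) (embed h).
Proof.
have -> : embed h = \sum_i (unitz i (h.1 i)%:Z, unitz i (h.2 i)).
  have -> : \sum_i (unitz i (h.1 i)%:Z, unitz i (h.2 i)) =
      (\sum_i unitz i (h.1 i)%:Z, \sum_i unitz i (h.2 i)) :> Zn * Zn.
    by elim/big_rec3: _ => // i a b c _ ->.
  by congr (_, _); apply/ffunP => j; rewrite sum_ffunE ?ffunE (bigD1 j) //= ffunE eqxx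
    big1 ?addr0 // => i /negPf ij; rewrite ffunE eq_sym ij.
by rewrite rmorph_prod; apply: is_top_prod => i; apply: is_top_rho_wmon.
Qed.

Lemma rho_lext g : rho (lext (pbw x y) g) = lext (fun h => rho (pbw x y h)) g.
Proof. by rewrite linear_sum; apply: eq_bigr => h _; rewrite linearZ_LR. Qed.

(** Distinct ordered monomials have distinct tops, so at the largest top occurring in [g] only one
    monomial contributes. This gives independence of the monomials and injectivity of [rho] at
    once. *)
Lemma rho_lext_neq0 (g : {malg K[idx]}) : g != 0 -> rho (lext (pbw x y) g) != 0.
Proof.
move=> g0; pose s : seq (Zn * Zn) := [seq embed h | h <- msupp g].
have /(seq_top Q) [_ /mapP [h hg ->] H] : s != [::].
  rewrite -size_eq0 size_map size_eq0; apply: contra g0 => /eqP E.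
  apply/eqP/malgP => k; rewrite mcoeff0; apply: mcoeff_outdom.
  by rewrite -[_ \in _]/(k \in (msupp g : seq _)) E.
suff : qcoef (embed h) (rho (lext (pbw x y) g)) != 0.
  by apply: contraNneq => ->; rewrite qcoef0.
rewrite rho_lext /lext qcoef_sum (bigD1_seq h) ?fset_uniq //= big1_seq ?addr0.
  rewrite qcoefZ; apply: mulf_neq0; first by rewrite mcoeff_neq0.
  by have [] := is_top_rho_pbw h.
move=> h' /andP [hh' gh']; rewrite qcoefZ.
have eh : embed h' != embed h by rewrite (inj_eq embed_inj).
have Qh := H _ (map_f embed gh') eh.
case: (eqVneq (qcoef (embed h) (rho (pbw x y h'))) 0) => [->|c0]; first by rewrite mulr0.
have [_ /(_ _ c0)] := is_top_rho_pbw h'.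
rewrite eq_sym eh => /(_ isT) Qh'.
by have := cpos_asym Qh; rewrite opprB Qh'.
Qed.

Lemma rho_inj : injective rho.
Proof.
move=> u v /eqP; rewrite -subr_eq0 -rmorphB => /eqP E; apply/eqP; rewrite -subr_eq0.
have [g Eg] := pbw_span hqL hA q1 (u - v); rewrite Eg in E *.
case: (eqVneq g 0) => [->|/rho_lext_neq0]; last by rewrite E eqxx.
by rewrite linear0.
Qed.

Lemma rho_eq0 u : (rho u == 0) = (u == 0).
Proof.
by apply/eqP/eqP => [E|->]; [apply: rho_inj; rewrite E|]; rewrite linear0.
Qed.

Lemma qweyl_mulf_neq0 (u v : A) : u != 0 -> v != 0 -> u * v != 0.
Proof.
move=> u0 v0; rewrite -rho_eq0 rmorphM.
by apply: (qtorus_mulf_neq0 (lexcone n)); rewrite rho_eq0.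
Qed.

Lemma qweyl_mulIf (u v w : A) : w != 0 -> u * w = v * w -> u = v.
Proof.
move=> w0 /eqP; rewrite -subr_eq0 -mulrBl => E; apply/eqP; rewrite -subr_eq0.
by apply: contraLR E => uv; apply: qweyl_mulf_neq0.
Qed.

(** This is what separates the image from the whole torus: inverses of Z_i are absent, and a
    monomial in the image that is free of X is a product of the z_i. *)
Lemma rho_nonneg u k i : qcoef k (rho u) != 0 -> 0 <= k.1 i.
Proof.
elim/(qweyl_ind hA): u k => [|a u v Hu Hv|j u Hu|j u Hu] k.
- rewrite rmorph1 -qmon0 qcoef_mon; case: (0 =P k) => [<-|]; last by rewrite eqxx.
  by rewrite ffunE.
- rewrite linearP qcoefD qcoefZ => H; have [Eu|/Hu //] := eqVneq (qcoef k (rho u)) 0.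
  by apply: Hv; move: H; rewrite Eu mulr0 add0r.
- rewrite rmorphM /= rx => /qcoefM_neq0 [l [p [lx /Hu Hp ->]]].
  rewrite /= ffunE addr_ge0 //; move: lx; rewrite qcoef_mon.
  by case: (_ =P l) => [<-|]; rewrite ?eqxx //= ffunE.
rewrite rmorphM /= ry => /qcoefM_neq0 [l [p [/qcoef_mY_neq0 ly /Hu Hp ->]]].
by rewrite /= ffunE addr_ge0 //; case: ly => -> /=; rewrite !ffunE.
Qed.

(** The grading by X-exponents, in which Z_i has degree 0, so both terms of y_i have degree -e_i
    although y_i is not a monomial. *)
Definition xhomog (d : Zn) (t : T) := forall k, qcoef k t != 0 -> k.2 = d.

Lemma xhomogM d e s t : xhomog d s -> xhomog e t -> xhomog (d + e) (s * t).
Proof. by move=> sd te k /qcoefM_neq0 [l [p [/sd <- /te <- ->]]]. Qed.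

Lemma xhomog_mon k : xhomog k.2 (qmon _ k).
Proof. by move=> l; rewrite qcoef_mon; case: (k =P l) => [->|]; rewrite ?eqxx. Qed.

Lemma xhomogX d t m : xhomog d t -> xhomog (d *+ m) (t ^+ m).
Proof.
move=> td; elim: m => [|m IH]; last by rewrite exprS mulrS; apply: xhomogM.
by rewrite expr0 -qmon0; apply: (@xhomog_mon 0).
Qed.

Lemma xhomog_mY i : xhomog (- unitf i) (mY hqL i).
Proof. by move=> k /qcoef_mY_neq0 [->|->] //=; rewrite sub0r. Qed.

Lemma xhomog_rho_wmon i s t : xhomog (unitz i t) (rho (wmon x y i s t)).
Proof.
rewrite rmorphM rmorphXn /= rho_z -[unitz i t]add0r -(mul0rn _ s).
apply: xhomogM; first exact/xhomogX/(@xhomog_mon (ez i)).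
case: t => k /=; rewrite rmorphXn /= ?rx ?ry.
  rewrite -unitfMn.
  exact/xhomogX/(@xhomog_mon (ex i)).
have -> : unitz i (Negz k) = (- unitf i) *+ k.+1.
  rewrite mulNrn unitfMn NegzE; apply/ffunP => j; rewrite !ffunE.
  by case: eqP => _ //; rewrite oppr0.
exact/xhomogX/xhomog_mY.
Qed.

Lemma xhomog_rho_pbw h : xhomog h.2 (rho (pbw x y h)).
Proof.
have -> : h.2 = \sum_i unitz i (h.2 i).
  by apply/ffunP => j; rewrite sum_ffunE (bigD1 j) //= ffunE eqxx
    big1 ?addr0 // => i /negPf ij; rewrite ffunE eq_sym ij.
rewrite rmorph_prod; elim: (index_enum _) => [|i r IH].
  by rewrite !big_nil -qmon0; apply: (@xhomog_mon 0).
by rewrite !big_cons; apply: xhomogM => //; apply: xhomog_rho_wmon.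
Qed.

(** Ordered monomials are homogeneous and [rho] is injective, so only those of degree [d] occur in
    [u]; divisibility need only be checked on them. *)
Lemma xhomog_factor d u v0 : xhomog d (rho u) ->
  (forall h : idx, h.2 = d -> exists v, pbw x y h = v * v0) ->
  exists v, u = v * v0.
Proof.
have [g ->] := pbw_span hqL hA q1 u => Hd Hv.
pose g1 := \sum_(h <- msupp g | h.2 == d) g@_h *: pbw x y h.
pose g2 := \sum_(h <- msupp g | h.2 != d) g@_h *: pbw x y h.
have E : lext (pbw x y) g = g1 + g2 by rewrite /lext (bigID (fun h => h.2 == d)).
(* In degree [d] the image of [g2] vanishes by construction; in any other degree both [u] and [g1]
   contribute nothing. *)
have g20 : g2 = 0.
  apply/eqP; rewrite -rho_eq0; apply/eqP/qcoefP => k; rewrite qcoef0.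
  have g1E : k.2 != d -> qcoef k (rho g1) = 0.
    move=> kd; rewrite linear_sum qcoef_sum big1 // => h /eqP hd.
    rewrite linearZ_LR qcoefZ; apply/eqP; rewrite mulf_eq0 orbC.
    by apply/orP; left; apply: contraR kd => /xhomog_rho_pbw ->; rewrite hd.
  have [kd|kd] := eqVneq k.2 d.
    rewrite linear_sum qcoef_sum big1 // => h hd.
    rewrite linearZ_LR qcoefZ; apply/eqP; rewrite mulf_eq0 orbC.
    by apply/orP; left; apply: contraR hd => /xhomog_rho_pbw <-; rewrite kd.
  have : qcoef k (rho (lext (pbw x y) g)) = 0.
    by apply/eqP; apply: contraR kd => /Hd ->.
  by rewrite E rmorphD qcoefD g1E // add0r.
rewrite E g20 addr0 /g1; elim/big_ind: _ => [|_ _ [v ->] [w ->]|h /eqP /Hv [v ->]].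
- by exists 0; rewrite mul0r.
- by exists (v + w); rewrite mulrDl.
- by exists (g@_h *: v); rewrite scalerAl.
Qed.

Lemma xhomog_x u i : xhomog (unitf i) (rho u) -> exists v, u = v * x i.
Proof.
move=> /xhomog_factor; apply=> h hd.
apply: (@pbw_mulr _ _ _ _ _ i h 0) => [j s t ji|].
  exact: x_wmon_scomm (hqL) (hA) _ _ _ _ ji.
by rewrite hd ffunE eqxx /= expr1 expr0 mul1r.
Qed.

Lemma xhomog_y u i : xhomog (- unitf i) (rho u) -> exists v, u = v * y i.
Proof.
move=> /xhomog_factor; apply=> h hd.
apply: (@pbw_mulr _ _ _ _ _ i h 0) => [j s t ji|].
  exact: y_wmon_scomm (hqL) (hA) _ _ _ _ ji.
by rewrite hd !ffunE eqxx /= expr1 expr0 mul1r.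
Qed.

End Embedding.

(** The inclusion of u A in A u for nonzero u refers to no generators, so an isomorphism must
    respect it. *)
Definition lnormal (K : fieldType) (A : algType K) (u : A) : Prop :=
  u != 0 /\ forall a, exists b, u * a = b * u.

(** * Normal elements and units *)

Section NormalElements.
Variables (K : fieldType) (n : nat) (q : 'I_n -> K) (L : 'I_n -> 'I_n -> K).
Variables (A : algType K) (x y : 'I_n -> A).
Hypotheses (hqL : qweyl_data q L) (hA : is_qweyl q L x y).
Hypothesis nru : forall i, not_root_of_unity (q i).
Local Notation z := (qz x y).
Local Notation Zn := {ffun 'I_n -> int}.
Local Notation c := (mbichar hqL).
Local Notation T := (qtorus c).
Local Notation P := (lexcone n).

Let hr : qweyl_rel q L x y. Proof. by case: hA. Qed.
Let q0 i : q i != 0. Proof. by case: hqL. Qed.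
Let q1 i : q i != 1. Proof. by have := @nru i 1%N isT; rewrite expr1. Qed.

Variable rho : {lrmorphism A -> T}.
Hypothesis hrho : forall i, rho (x i) = mX hqL i /\ rho (y i) = mY hqL i.
Let rx i : rho (x i) = mX hqL i. Proof. by case: (hrho i). Qed.
Let ry i : rho (y i) = mY hqL i. Proof. by case: (hrho i). Qed.
Let rz i : rho (z i) = mZ hqL i. Proof. exact: (rho_z hA q1 hrho). Qed.
Let rinj : injective rho. Proof. exact: (rho_inj hA q1 hrho). Qed.
Let req0 u : (rho u == 0) = (u == 0). Proof. exact: (rho_eq0 hA q1 hrho). Qed.

Lemma qmon_neq0 k : qmon c k != 0.
Proof. exact: is_top_neq0 (is_top_qmon hqL k). Qed.

Lemma x_neq0 i : x i != 0.
Proof. by rewrite -req0 rx qmon_neq0. Qed.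

Lemma y_neq0 i : y i != 0.
Proof. by rewrite -req0 ry; apply: is_top_neq0 (is_top_mY hqL q1 i). Qed.

Lemma z_neq0 i : z i != 0.
Proof. by rewrite -req0 rz qmon_neq0. Qed.

Lemma z_lnormal i : lnormal (z i).
Proof.
split; first exact: z_neq0.
have step (g u : A) : (exists a, scomm a (z i) g) -> (exists b, z i * u = b * z i) ->
    exists b, z i * (g * u) = b * z i.
  move=> [a E] [b Eb]; exists (a *: (g * b)).
  by rewrite mulrA E -!scalerAl -!mulrA Eb.
elim/(qweyl_ind hA) => [|a u v [b Eb] [d Ed]|j u|j u].
- by exists 1; rewrite mulr1 mul1r.
- by exists (a *: b + d); rewrite mulrDr [(a *: b + d) * _]mulrDl -scalerAr -scalerAl Eb Ed.
- apply: step; case: (eqVneq i j) => [<-|/(rel_zx hqL hr)]; last by exists 1.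
  by exists (q i)^-1; apply: scomm_sym (q0 i) (rel_xz hr i).
apply: step; case: (eqVneq i j) => [<-|/(rel_zy hqL hr)]; last by exists 1.
by exists (q i); apply: rel_zyi hr i.
Qed.

Lemma is_top_mZ1P i : is_top P (mZ hqL i - 1) (ez i).
Proof.
split; first by rewrite qcoef_mZ1 eqxx [0 == ez i]eq_sym (negPf (ez_neq0 i)) subr0 oner_eq0.
move=> l /qcoef_mZ1_neq0 [->|->]; first by rewrite eqxx.
move=> _; rewrite /= subr0 /lexpos2 /=; apply/orP; left.
apply/lexposP; exists i => [|j ji]; rewrite ffunE ?eqxx //.
by case: eqP ji => // ->; rewrite ltnn.
Qed.

(* A left inverse of x i would have degree - e_i, so it would be a left multiple of
   y i and make (z i - 1) invertible. *)
Lemma x_no_left_inverse i v : v * x i != 1.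
Proof.
apply/eqP => /(congr1 rho); rewrite rmorphM rmorph1 /= rx => E.
have rv : rho v = mW hqL i by rewrite -[LHS]mulr1 -(mX_mW hqL i) mulrA E mul1r.
have [|w Ew] := xhomog_y hA q1 hrho (u := v) (i := i).
  by rewrite rv; apply: (@xhomog_mon _ _ _ _ hqL (- ex i)).
move: E; rewrite Ew rmorphM /= ry -mulrA mY_mX -scalerAr => E.
have w0 : rho w != 0.
  apply: contraTneq (oner_neq0 T) => w0.
  by rewrite -E w0 mul0r scaler0 eqxx.
have [k wk] := ex_top P w0.
have s0 : (q i - 1)^-1 != 0 by rewrite invr_eq0 subr_eq0.
have := is_topZ s0 (is_top_mul wk (is_top_mZ1P i)); rewrite E => kez.
have k1 := is_top_uniq kez (is_top1 c P).
case: wk => wk _; have := rho_nonneg hA hrho i wk.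
have -> : k = - ez i by apply/eqP; rewrite -addr_eq0 k1.
by rewrite /= !ffunE eqxx.
Qed.

(** [qtorus_conj_mon] makes the conjugate a multiple of the monomial, and injectivity of [rho]
    brings this back. It applies to x_i and z_i, but not to y_i. *)
Lemma lnormal_conj u k g :
  lnormal u -> rho g = qmon c k -> exists a, scomm a u g.
Proof.
move=> [u0 un] gk; have [w E] := un g.
have E' : rho u * qmon c k = rho w * rho u by rewrite -gk -!rmorphM E.
have ru0 : rho u != 0 by rewrite req0.
have wE := qtorus_conj_mon P ru0 E'.
exists (qcoef k (rho w)); apply: rinj; rewrite linearZ_LR !rmorphM /= gk E' {1}wE.
by rewrite scalerAl.
Qed.

Lemma scomm_neq0 u a i : lnormal u -> scomm a u (x i) -> a != 0.
Proof.
move=> [u0 _]; rewrite /scomm => E; apply: contraTneq u0 => a0.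
have := qweyl_mulf_neq0 hA q1 hrho (u := u) (v := x i).
by rewrite E a0 scale0r eqxx x_neq0; case: eqP => // _ /(_ isT isT).
Qed.

Lemma scomm_rho_supp a u g k l : scomm a u g -> rho g = qmon c k ->
  qcoef l (rho u) != 0 -> c l k = a * c k l.
Proof.
move=> E gk; apply: qmon_comm_supp.
by rewrite -gk -!rmorphM -linearZ_LR /= E.
Qed.

(** Z_i commutes with every monomial up to the power of q_i given by its X_i-exponent, so z_i acts
    as a degree meter. *)
Lemma scomm_z_degree a u i l :
  scomm a u (z i) -> qcoef l (rho u) != 0 -> q i ^ l.2 i = a.
Proof.
move=> E /(scomm_rho_supp E (rz i)).
by rewrite mchar_ezl mchar_ezr mulr1.
Qed.

Lemma rho_scommz_xhomog (e : Zn) u :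
  (forall i, scomm (q i ^ e i) u (z i)) -> xhomog e (rho u).
Proof.
move=> E k uk; apply/ffunP => i; apply: (expfz_inj (q0 i) (@nru i)).
exact: scomm_z_degree (E i) uk.
Qed.

Definition zpow (a : 'I_n -> nat) : A := \prod_i z i ^+ a i.

Definition zdeg (a : 'I_n -> nat) : Zn * Zn := ([ffun i => (a i)%:Z], 0).

Lemma mchar_z k l : k.2 = 0 -> c k l = 1.
Proof.
move=> k0; rewrite /= /mchar k0 !big1 ?mulr1 // => i _.
  by rewrite big1 // => j _; rewrite ffunE mul0r expr0z.
by rewrite ffunE mul0r expr0z.
Qed.

Lemma rho_zpow a : rho (zpow a) = qmon c (zdeg a).
Proof.
have -> : zdeg a = \sum_(i < n) (ez i *+ a i).
  under eq_bigr do rewrite ezMn.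
  have -> : \sum_(i < n) (unitz i (a i)%:Z, 0) =
      (\sum_(i < n) unitz i (a i)%:Z, 0) :> Zn * Zn.
    by elim/big_rec2: _ => // i b d _ ->; congr (_, _); rewrite /= addr0.
  by congr (_, _); apply/ffunP => j; rewrite sum_ffunE ?ffunE (bigD1 j) //= ffunE eqxx
    big1 ?addr0 // => i /negPf ij; rewrite ffunE eq_sym ij.
have ZX i m : qmon c (ez i) ^+ m = qmon c (ez i *+ m).
  elim: m => [|m IH]; first by rewrite expr0 mulr0n qmon0.
  by rewrite exprS IH qmonM mchar_ezl scale1r mulrS.
rewrite rmorph_prod; elim: (index_enum _) => [|i r IH].
  by rewrite !big_nil qmon0.
have ez2 : (ez i *+ a i).2 = 0 by rewrite ezMn.
by rewrite !big_cons IH rmorphXn /= rz ZX qmonM (mchar_z _ ez2) scale1r.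
Qed.

Lemma lnormal_zpow u : lnormal u -> exists a e, a != 0 /\ u = a *: zpow e.
Proof.
move=> nu; have u0 : rho u != 0 by rewrite req0; case: nu.
have [k [uk _]] := ex_top P u0.
(* The scalars against the z_i fix the X-exponents; once these agree, the powers of [L] cancel in
   the scalars against the x_i, which then fix the Z-exponents. *)
have kE l : qcoef l (rho u) != 0 -> l = k.
  move=> ul; have E2 : l.2 = k.2.
    apply/ffunP => i; apply: (expfz_inj (q0 i) (@nru i)).
    have [a E] := lnormal_conj nu (rz i).
    by rewrite (scomm_z_degree E ul) (scomm_z_degree E uk).
  case: l k ul uk E2 => [l1 l2] [k1 k2] ul uk /= E2; rewrite E2 in ul *.
  congr (_, _); apply/ffunP => i; apply: (expfz_inj (q0 i) (@nru i)).
  have [a E] := lnormal_conj nu (rx i).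
  have := scomm_rho_supp E (rx i) uk; have := scomm_rho_supp E (rx i) ul.
  rewrite !mchar_exr !mchar_exl /= => -> /(mulfI (scomm_neq0 nu E)).
  by apply: mulIf; apply/prodf_neq0 => j _; apply/expfz_neq0/(upperL_neq0 hqL).
have uE : rho u = qcoef k (rho u) *: qmon c k.
  apply: qcoefP => l; rewrite qcoefZ qcoef_mon.
  case: (k =P l) => [<-|kl]; first by rewrite mulr1.
  by rewrite mulr0; apply/eqP; apply: contra_notT kl => /kE.
(* It suffices that [u] commutes with z_i, that is a = 1. Computing u y_i x_i through u y_i = w u
   and through z_i gives (b w - a y_i) x_i = s (a - 1), so a different from 1 would give x_i a left
   inverse. *)
have k2 : k.2 = 0.
  apply/ffunP => i; rewrite ffunE; apply: (expfz_eq1 (@nru i)).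
  have [a Ea] := lnormal_conj nu (rz i); rewrite (scomm_z_degree Ea uk).
  have [b Eb] := lnormal_conj nu (rx i); have [w Ew] := (proj2 nu) (y i).
  pose s := (q i - 1)^-1; have s0 : s != 0 by rewrite invr_eq0 subr_eq0.
  have E : (b *: w - a *: y i) * x i = (s * (a - 1)) *: 1.
    apply: (qweyl_mulIf hA q1 hrho (w := u)); first by case: nu.
    have E1 : u * (y i * x i) = b *: (w * x i) * u.
      by rewrite mulrA Ew -mulrA Eb -scalerAr mulrA scalerAl.
    have E2 : u * (y i * x i) = (s * a) *: (z i * u) - s *: u.
      by rewrite (rel_yxz hr q1) mulrBr -!scalerAr Ea scalerA mulr1.
    have E3 : a *: (y i * x i) * u = (s * a) *: (z i * u) - (s * a) *: u.
      rewrite (rel_yxz hr q1) -scalerAl [(_ - _) * u]mulrBl -!scalerAl mul1r.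
      by rewrite scalerBr !scalerA mulrC.
    rewrite mulrBl -!scalerAl mulrBl [b *: _]scalerAl -scalerAl -E1 E2 E3.
    by rewrite opprB addrC subrKA -scalerBl mul1r mulrBr mulr1.
  apply/eqP; apply: contraT => a1; have sa0 : s * (a - 1) != 0.
    by rewrite mulf_neq0 // subr_eq0.
  have /eqP[] := x_no_left_inverse i ((s * (a - 1))^-1 *: (b *: w - a *: y i)).
  by rewrite -scalerAl E scalerA mulVf // scale1r.
(* The absolute value only converts to naturals, since [rho_nonneg] gives the sign. *)
exists (qcoef k (rho u)), (fun i => `|k.1 i|%N); split=> //.
apply: rinj; rewrite linearZ_LR /= rho_zpow {1}uE; congr (_ *: qmon _ _).
rewrite (surjective_pairing k) k2; congr (_, _); apply/ffunP => i.
by rewrite ffunE gez0_abs //; apply: (rho_nonneg hA hrho i uk).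
Qed.

Lemma is_top_zpow (Q : cone (Zn * Zn)%type) a : is_top Q (rho (zpow a)) (zdeg a).
Proof.
by rewrite rho_zpow -[qmon _ _]scale1r; apply/is_top_mon/oner_neq0.
Qed.

(** A one-sided inverse in a domain is two-sided, and units are normal; so [f] and [g] are monomials
    in the z_i up to scalars. Their natural exponents add up to 0, hence all vanish. *)
Lemma inv_scalar (f g : A) : f * g = 1 -> exists2 a, a != 0 & f = a *: 1.
Proof.
move=> fg; have f0 : f != 0.
  by apply: contraTneq (oner_neq0 A) => f0; rewrite -fg f0 mul0r eqxx.
have g0 : g != 0.
  by apply: contraTneq (oner_neq0 A) => g0; rewrite -fg g0 mulr0 eqxx.
have gf : g * f = 1.
  by apply: (qweyl_mulIf hA q1 hrho g0); rewrite -mulrA fg mulr1 mul1r.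
have nf : lnormal f by split=> // a; exists (f * a * g); rewrite -mulrA gf mulr1.
have ng : lnormal g by split=> // a; exists (g * a * f); rewrite -mulrA fg mulr1.
have [a [e [a0 fE]]] := lnormal_zpow nf; have [b [d [b0 gE]]] := lnormal_zpow ng.
exists a => //; rewrite fE; congr (_ *: _).
have := is_top_mul (is_topZ a0 (is_top_zpow P e)) (is_topZ b0 (is_top_zpow P d)).
rewrite -!linearZ_LR -rmorphM -fE -gE fg rmorph1 => /is_top_uniq /(_ (is_top1 c P)) E.
rewrite /zpow big1 // => i _.
have /= /ffunP /(_ i) := congr1 fst E; rewrite !ffunE => ed.
by have -> : e i = 0%N by lia.
Qed.

End NormalElements.

(** * Transport along an isomorphism *)

Lemma lrmorphism_inverse (K : fieldType) (A C : algType K) (phi : {lrmorphism A -> C}) :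
  bijective phi ->
  exists psi : {lrmorphism C -> A}, cancel phi psi /\ cancel psi phi.
Proof.
move=> [g phiK gK].
have glin : linear g by move=> a u v; apply: (can_inj phiK); rewrite gK linearP /= !gK.
have gmon : monoid_morphism g.
  split=> [|u v]; apply: (can_inj phiK); first by rewrite gK rmorph1.
  by rewrite rmorphM /= !gK.
pose psi : {lrmorphism C -> A} := HB.pack_for {lrmorphism C -> A} g
  (GRing.isLinear.Build K C A *:%R g glin) (GRing.isMonoidMorphism.Build C A g gmon).
by exists psi.
Qed.

Lemma lnormal_iso (K : fieldType) (A C : algType K) (phi : {lrmorphism A -> C})
    (psi : {lrmorphism C -> A}) u :
  cancel phi psi -> cancel psi phi -> lnormal u -> lnormal (phi u).
Proof.
move=> phiK psiK [u0 un]; split.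
  by apply: contra u0 => /eqP E; rewrite -[u]phiK E linear0.
move=> a; have [b E] := un (psi a); exists (phi b).
by rewrite -rmorphM -E rmorphM /= psiK.
Qed.

Lemma scomm_morph (K : fieldType) (A C : algType K) (phi : {lrmorphism A -> C}) a u v :
  scomm a u v -> scomm a (phi u) (phi v).
Proof. by move=> E; rewrite /scomm -!rmorphM -linearZ_LR E. Qed.

Lemma scommZrI (K : fieldType) (A : algType K) a b (u v : A) :
  b != 0 -> scomm a u (b *: v) -> scomm a u v.
Proof. by move=> b0 /(scommZr b^-1); rewrite scalerA mulVf // scale1r. Qed.

Lemma scommZlI (K : fieldType) (A : algType K) a b (u v : A) :
  b != 0 -> scomm a (b *: u) v -> scomm a u v.
Proof. by move=> b0 /(scommZl b^-1); rewrite scalerA mulVf // scale1r. Qed.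

Lemma scomm_uniq (K : fieldType) (A : algType K) a b (u v : A) :
  v * u != 0 -> scomm a u v -> scomm b u v -> a = b.
Proof.
rewrite /scomm => vu -> /eqP; rewrite -subr_eq0 -scalerBl scaler_eq0 (negPf vu) orbF.
by rewrite subr_eq0 => /eqP.
Qed.

Section Isomorphism.
Variables (K : fieldType) (n m : nat).
Variables (q : 'I_n -> K) (L : 'I_n -> 'I_n -> K).
Variables (q' : 'I_m -> K) (L' : 'I_m -> 'I_m -> K).
Variables (A : algType K) (x y : 'I_n -> A) (C : algType K) (x' y' : 'I_m -> C).
Hypotheses (hqL : qweyl_data q L) (hqL' : qweyl_data q' L').
Hypothesis nru : forall i, not_root_of_unity (q i).
Hypothesis nru' : forall i, not_root_of_unity (q' i).
Hypotheses (hA : is_qweyl q L x y) (hC : is_qweyl q' L' x' y').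
Variables (phi : {lrmorphism A -> C}) (psi : {lrmorphism C -> A}).
Hypotheses (phiK : cancel phi psi) (psiK : cancel psi phi).
Local Notation z := (qz x y).
Local Notation z' := (qz x' y').

(* The exponent vectors of the phi (z i) and the psi (z' j) form mutually inverse
   matrices of natural numbers, hence permutation matrices. *)
Lemma iso_z : exists sigma : 'I_n -> 'I_m, injective sigma /\
  forall i, exists2 a, a != 0 & phi (z i) = a *: z' (sigma i).
Proof.
have q1 i : q i != 1 by have := @nru i 1%N isT; rewrite expr1.
have q1' i : q' i != 1 by have := @nru' i 1%N isT; rewrite expr1.
have [rho hrho] := ex_rho hqL hA q1.
have [rho' hrho'] := ex_rho hqL' hC q1'.
have rz i : rho (z i) = mZ hqL i by apply: (rho_z hA q1 hrho).
suff H i : exists j, exists2 a, a != 0 & phi (z i) = a *: z' j.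
  have [sigma Hs] := fin_all_exists H; exists sigma; split=> // i j ij.
  have [a a0 Ea] := Hs i; have [b b0 Eb] := Hs j.
  have E : z i = (a / b) *: z j.
    apply: (can_inj phiK); rewrite linearZ_LR /= Ea Eb ij scalerA.
    by rewrite -mulrA mulVf // mulr1.
  have := congr1 (fun u => qcoef (ez i) (rho u)) E.
  rewrite linearZ_LR /= !rz qcoefZ !qcoef_mon eqxx.
  case: (ez j =P ez i) => [/(congr1 fst) /= /ffunP /(_ i)|_ /eqP].
    by rewrite !ffunE eqxx; case: eqP.
  by rewrite mulr0 oner_eq0.
have /fin_all_exists [e He] : forall j, exists e, exists2 a, a != 0 & psi (z' j) = a *: zpow x y e.
  move=> j; have nz := lnormal_iso psiK phiK (z_lnormal hC nru' hrho' j).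
  by have [a [e [a0 E]]] := lnormal_zpow hA nru hrho nz; exists e, a.
have nz := lnormal_iso phiK psiK (z_lnormal hA nru hrho i).
have [a [d [a0 Ed]]] := lnormal_zpow hC nru' hrho' nz.
have key k : ((k == i) = \sum_j d j * e j k :> nat)%N.
  have : is_top (lexcone n) (rho (psi (phi (z i)))) (ez i).
    rewrite phiK rz -[mZ _ _]scale1r; exact/is_top_mon/oner_neq0.
  rewrite Ed !linearZ_LR /= !rmorph_prod => top1.
  have top2 : is_top (lexcone n) (a *: \prod_j rho (psi (z' j ^+ d j)))
      (\sum_j zdeg (e j) *+ d j).
    apply: is_topZ a0 _; apply: is_top_prod => j; rewrite !rmorphXn /=.
    apply: is_top_exp; have [b b0 ->] := He j; rewrite linearZ_LR /=.
    exact: is_topZ b0 (is_top_zpow hA nru hrho _ _).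
  have /(congr1 fst) /= /ffunP /(_ k) := is_top_uniq top1 top2.
  rewrite ffunE => Ek; apply/eqP; rewrite -eqz_nat; apply/eqP; rewrite {}Ek.
  elim/big_rec2: _ => [|j b f _ IH]; first by rewrite ffunE.
  rewrite /= ffunE IH PoszD; congr (_ + _).
  elim: (d j) => [|s IHs]; first by rewrite mulr0n ffunE mul0n.
  by rewrite mulrS /= ffunE IHs ffunE mulSn PoszD.
(* Some term of a sum equal to 1 is positive. For that [j] the vector [e j] can have no other entry,
   so psi (z' j) is a multiple of z_i; applying [phi] to this avoids any discussion of the other
   entries of [d]. *)
have /existsP [j dej] : [exists j, 0 < d j * e j i]%N.
  apply: contraT => /existsPn H; have := key i; rewrite eqxx big1 // => j _.
  by apply/eqP; rewrite -leqn0 leqNgt H.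
have le k : (d j * e j k <= (k == i))%N by rewrite key (bigD1 j) //= leq_addr.
have ej k : e j k = (k == i).
  move: dej (le k); rewrite muln_gt0 => /andP [d0 e0]; case: eqP => [->|_] /=.
    by move=> h; nia.
  by rewrite leqn0 muln_eq0 => /orP [] /eqP h //; rewrite h in d0.
have [b b0 Eb] := He j; exists j, b^-1; first by rewrite invr_eq0.
have -> : z i = b^-1 *: psi (z' j).
  rewrite Eb scalerA mulVf // scale1r; apply: (rho_inj hA q1 hrho).
  have Ez : zdeg (e j) = ez i.
    by congr (_, _); apply/ffunP => k; rewrite !ffunE ej.
  by rewrite (rho_zpow hA nru hrho (e j)) Ez (rz i).
by rewrite linearZ_LR /= psiK.
Qed.

(** Equal ranks make [sigma] onto, so the commutation of the image with every z'_l is known, and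
    with it the degree of the image. *)
Lemma scomm_iso_z sigma e i : injective sigma -> n = m ->
  (forall i, exists2 a, a != 0 & phi (z i) = a *: z' (sigma i)) ->
  forall u, scomm e u (z i) -> (forall j, j != i -> scomm 1 u (z j)) ->
  forall l, scomm (if l == sigma i then e else 1) (phi u) (z' l).
Proof.
move=> sI nm Hz u ui uj l.
have [tau _ tauK] : bijective sigma by apply: inj_card_bij; rewrite ?card_ord ?nm.
rewrite -[l]tauK (inj_eq sI); have [a a0 E] := Hz (tau l).
apply: (scommZrI a0); rewrite -E; apply: scomm_morph.
by case: eqP => [->|/eqP /uj].
Qed.

End Isomorphism.

(** * Images of the x_i and comparison of parameters *)

Section ImageOfGenerators.
Variables (K : fieldType) (n m : nat).
Variables (q : 'I_n -> K) (L : 'I_n -> 'I_n -> K).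
Variables (q' : 'I_m -> K) (L' : 'I_m -> 'I_m -> K).
Variables (A : algType K) (x y : 'I_n -> A) (C : algType K) (x' y' : 'I_m -> C).
Hypotheses (hqL : qweyl_data q L) (hqL' : qweyl_data q' L').
Hypothesis nru : forall i, not_root_of_unity (q i).
Hypothesis nru' : forall i, not_root_of_unity (q' i).
Hypotheses (hA : is_qweyl q L x y) (hC : is_qweyl q' L' x' y').
Variables (phi : {lrmorphism A -> C}) (psi : {lrmorphism C -> A}).
Hypotheses (phiK : cancel phi psi) (psiK : cancel psi phi).
Local Notation z := (qz x y).
Local Notation z' := (qz x' y').

Variable sigma : 'I_n -> 'I_m.
Hypotheses (sI : injective sigma) (nm : n = m).
Hypothesis Hz : forall i, exists2 a, a != 0 & phi (z i) = a *: z' (sigma i).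

Let q0 i : q i != 0. Proof. by case: hqL. Qed.
Let q0' i : q' i != 0. Proof. by case: hqL'. Qed.
Let q1 i : q i != 1. Proof. by have := @nru i 1%N isT; rewrite expr1. Qed.
Let q1' i : q' i != 1. Proof. by have := @nru' i 1%N isT; rewrite expr1. Qed.
Let hr := proj1 hA.
Let hr' := proj1 hC.

Lemma phi_x i :
  (q' (sigma i) = q i /\ exists2 a, a != 0 & phi (x i) = a *: x' (sigma i)) \/
  (q' (sigma i) = (q i)^-1 /\ exists2 a, a != 0 & phi (x i) = a *: y' (sigma i)).
Proof.
have [rho hrho] := ex_rho hqL hA q1.
have [rho' hrho'] := ex_rho hqL' hC q1'.
have [tau tauK sigmaK] : bijective sigma.
  by apply: inj_card_bij; rewrite ?card_ord ?nm.
have tI : injective tau by apply: can_inj sigmaK.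
have Hz' k : exists2 a, a != 0 & psi (z' k) = a *: z (tau k).
  have [a a0 E] := Hz (tau k); exists a^-1; first by rewrite invr_eq0.
  rewrite -{1}[k]sigmaK; apply: (can_inj phiK); rewrite psiK linearZ_LR /= E.
  by rewrite scalerA mulVf // scale1r.
pose k := sigma i; have ti : tau k = i by rewrite tauK.
have sx : forall l, scomm (if l == k then q i else 1) (phi (x i)) (z' l).
  apply: (scomm_iso_z sI nm Hz); first exact: (rel_xz hr).
  move=> j ji; have := scomm_sym (oner_neq0 K) (rel_zx hqL hr ji).
  by rewrite invr1.
have sx' : forall l, scomm (if l == i then q' k else 1) (psi (x' k)) (z l).
  rewrite -{1}ti; apply: (scomm_iso_z tI (esym nm) Hz'); first exact: (rel_xz hr').
  move=> j jk; have := scomm_sym (oner_neq0 K) (rel_zx hqL' hr' jk).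
  by rewrite invr1.
have sy' : forall l, scomm (if l == i then (q' k)^-1 else 1) (psi (y' k)) (z l).
  rewrite -{1}ti; apply: (scomm_iso_z tI (esym nm) Hz').
    exact: scomm_sym (q0' k) (rel_zyi hr' k).
  move=> j jk; have := scomm_sym (oner_neq0 K) (rel_zy hqL' hr' jk).
  by rewrite invr1.
have phix0 : phi (x i) != 0.
  apply: contra (x_neq0 hA nru hrho i) => /eqP E.
  by rewrite -[x i]phiK E linear0.
have psix0 : psi (x' k) != 0.
  apply: contra (x_neq0 hC nru' hrho' k) => /eqP E.
  by rewrite -[x' k]psiK E linear0.
(* Any exponent in the support of the image of x_i will do: its X_k-component is measured by z'_k,
   whose scalar is q_i. *)
have [D ED] : exists D : int, q' k ^ D = q i.
  have rp0 : rho' (phi (x i)) != 0 by rewrite (rho_eq0 hC q1' hrho').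
  have [l [lx _]] := ex_top (lexcone m) rp0; exists (l.2 k).
  by have := sx k; rewrite eqxx => /(scomm_z_degree hC nru' hrho'); apply.
have [D' ED'] : exists D : int, q i ^ D = q' k.
  have rp0 : rho (psi (x' k)) != 0 by rewrite (rho_eq0 hA q1 hrho).
  have [l [lx _]] := ex_top (lexcone n) rp0; exists (l.2 i).
  by have := sx' i; rewrite eqxx => /(scomm_z_degree hA nru hrho); apply.
have DD : D' * D = 1.
  by apply: (expfz_inj (q0 i) (@nru i)); rewrite -exprz_exp ED' ED expr1z.
have hom u (e : int) : (forall l, scomm (if l == i then q i ^ e else 1) u (z l)) ->
    xhomog (unitz i e) (rho u).
  move=> H; apply: (rho_scommz_xhomog hA nru hrho) => l; rewrite ffunE.
  by have := H l; case: eqP => [->|_] //; rewrite expr0z.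
have hom' u (e : int) : (forall l, scomm (if l == k then q' k ^ e else 1) u (z' l)) ->
    xhomog (unitz k e) (rho' u).
  move=> H; apply: (rho_scommz_xhomog hC nru' hrho') => l; rewrite ffunE.
  by have := H l; case: eqP => [->|_] //; rewrite expr0z.
have unit1 p (j : 'I_p) : unitz j 1 = unitf j.
  by apply/ffunP => l; rewrite !ffunE; case: eqP.
have unitN1 p (j : 'I_p) : unitz j (-1) = - unitf j.
  by apply/ffunP => l; rewrite !ffunE; case: eqP.
(* Applying [psi] to phi (x_i) = f u gives x_i = psi(f) g x_i; cancelling x_i in the domain makes
   [f] invertible, hence a scalar. *)
have fin f (u : C) : phi (x i) = f * u -> (exists g, psi u = g * x i) ->
    exists2 a, a != 0 & phi (x i) = a *: u.
  move=> Ef [g Eg].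
  have E : psi f * g = 1.
    apply: (qweyl_mulIf hA q1 hrho (x_neq0 hA nru hrho i)).
    by rewrite mul1r -mulrA -Eg -rmorphM -Ef /= phiK.
  have {E} : f * phi g = 1 by rewrite -[f]psiK -rmorphM E rmorph1.
  move=> /(inv_scalar hC nru' hrho') [a a0 fa]; exists a => //.
  by rewrite Ef fa -scalerAl mul1r.
(* Each parameter is a power of the other, and the product of the two integer exponents is 1. The
   sign of [D] decides the part in which the index lies. *)
have [D1|D1] : D = 1 \/ D = -1.
  have /eqP : (`|D'| * `|D| = 1)%N by rewrite -abszM DD.
  by rewrite muln_eq1 => /andP [_ /eqP]; lia.
  left; have qq : q' k = q i by rewrite -ED D1 expr1z.
  split=> //; have [|f Ef] := xhomog_x hC q1' hrho' (u := phi (x i)) (i := k).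
    by rewrite -unit1; apply: hom' => l; rewrite expr1z qq; apply: sx.
  apply: (fin f) => //; apply: (xhomog_x hA q1 hrho).
  by rewrite -unit1; apply: hom => l; rewrite expr1z -qq; apply: sx'.
right; have qq : q' k = (q i)^-1 by rewrite -ED D1 exprN1 invrK.
split=> //; have [|f Ef] := xhomog_y hC q1' hrho' (u := phi (x i)) (i := k).
  rewrite -unitN1; apply: hom' => l; rewrite exprN1 qq invrK; exact: sx.
apply: (fin f) => //; apply: (xhomog_x hA q1 hrho).
by rewrite -unit1; apply: hom => l; rewrite expr1z -[q i]invrK -qq; apply: sy'.
Qed.

Lemma iso_cond : exists P1 : {set 'I_n}, qweyl_iso_cond q L q' L' P1 sigma.
Proof.
have [rho' hrho'] := ex_rho hqL' hC q1'.
pose inP1 i := q' (sigma i) = q i /\ exists2 a, a != 0 & phi (x i) = a *: x' (sigma i).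
exists [set i | `[< inP1 i >]].
have H1 i : i \in [set i | `[< inP1 i >]] -> inP1 i by rewrite inE => /asboolP.
have H2 i : i \notin [set i | `[< inP1 i >]] ->
    q' (sigma i) = (q i)^-1 /\ exists2 a, a != 0 & phi (x i) = a *: y' (sigma i).
  by rewrite inE => /asboolP ni; case: (phi_x i).
(* In a domain two nonzero elements commute up to at most one scalar, so the relation of x_i and x_j
   can be compared with that of their images. *)
have LL i j (u v : C) a b d : i != j -> u != 0 -> v != 0 -> a != 0 -> b != 0 ->
    phi (x i) = a *: u -> phi (x j) = b *: v -> scomm d u v -> d = L i j.
  move=> ij u0 v0 a0 b0 Ea Eb uv.
  apply: (scomm_uniq _ uv); first exact: (qweyl_mulf_neq0 hC q1' hrho').
  apply: (scommZrI b0); apply: (scommZlI a0); rewrite -Ea -Eb.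
  exact/scomm_morph/(rel_xx hqL hr ij).
have x0 k := x_neq0 hC nru' hrho' k; have y0 k := y_neq0 hC nru' hrho' k.
split=> [i /H1 [] //|i /H2 [] //|i j|i j iP jP].
  case: (eqVneq i j) => [-> _|ij]; first by case: hqL hqL' => _ _ _ _ -> [_ _ _ _ ->].
  have sij : sigma i != sigma j by rewrite (inj_eq sI).
  case: (boolP (i \in _)) => iP; case: (boolP (j \in _)) => jP // _.
    have [_ [a a0 Ea]] := H1 _ iP; have [_ [b b0 Eb]] := H1 _ jP.
    by apply: LL Ea Eb _ => //; apply: (rel_xx hqL' hr' sij).
  have [_ [a a0 Ea]] := H2 _ iP; have [_ [b b0 Eb]] := H2 _ jP.
  by apply: LL Ea Eb _ => //; apply: (rel_yy hqL' hr' sij).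
have ij : i != j by apply: contraTneq iP => ->.
have sij : sigma i != sigma j by rewrite (inj_eq sI).
have [_ [a a0 Ea]] := H1 _ iP; have [_ [b b0 Eb]] := H2 _ jP.
by apply: LL Ea Eb _ => //; apply: (rel_xy hr' sij).
Qed.

End ImageOfGenerators.

(** * Construction of the isomorphism from the parameters *)

Section Converse.
Variables (K : fieldType) (n m : nat).
Variables (q : 'I_n -> K) (L : 'I_n -> 'I_n -> K).
Variables (q' : 'I_m -> K) (L' : 'I_m -> 'I_m -> K).
Variables (A : algType K) (x y : 'I_n -> A) (C : algType K) (x' y' : 'I_m -> C).
Hypotheses (hqL : qweyl_data q L) (hqL' : qweyl_data q' L').
Hypotheses (hA : is_qweyl q L x y) (hC : is_qweyl q' L' x' y').
Variables (P1 : {set 'I_n}) (sigma : 'I_n -> 'I_m) (alpha : 'I_n -> K).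
Hypotheses (sI : injective sigma) (cond : qweyl_iso_cond q L q' L' P1 sigma).
Hypothesis alpha0 : forall i, alpha i != 0.

Definition imx i : C := alpha i *: (if i \in P1 then x' (sigma i) else y' (sigma i)).
(** Outside [P1] one has q' = 1/q, and y' x' - q x' y' = -q (x' y' - q' y' x') = -q; the factor -1/q
    restores the value 1. *)
Definition imy i : C :=
  if i \in P1 then (alpha i)^-1 *: y' (sigma i)
  else - ((q i)^-1 * (alpha i)^-1) *: x' (sigma i).

Lemma im_rel : qweyl_rel q L imx imy.
Proof.
have [c1 c2 c3 c4] := cond; have hr' := proj1 hC.
have q0 i : q i != 0 by case: hqL.
have LV i j : L i j = (L j i)^-1 by case: hqL.
have LV' i j : L' i j = (L' j i)^-1 by case: hqL'.
have E1 i j : (i \in P1) = (j \in P1) -> L i j = L' (sigma i) (sigma j).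
  by move/c3.
have E2 i j : (i \in P1) != (j \in P1) -> L i j = L' (sigma j) (sigma i).
  case: (boolP (i \in P1)) => iP; case: (boolP (j \in P1)) => jP // _.
    by rewrite c4.
  by rewrite LV' LV c4.
have sij i j : i != j -> sigma i != sigma j by rewrite (inj_eq sI).
have xx i j : i != j -> scomm (L i j) (imx i) (imx j).
  move=> /sij ij; apply/scommZl/scommZr; move: (E1 i j) (E2 i j).
  case: (i \in P1); case: (j \in P1).
  - by move=> /(_ erefl) -> _; apply: (rel_xx hqL' hr' ij).
  - by move=> _ /(_ isT) ->; apply: (rel_xy hr' ij).
  - by move=> _ /(_ isT) ->; apply: (rel_yx hqL' hr' ij).
  - by move=> /(_ erefl) -> _; apply: (rel_yy hqL' hr' ij).
have yy i j : i != j -> scomm (L i j) (imy i) (imy j).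
  move=> /sij ij; rewrite /imy; move: (E1 i j) (E2 i j).
  case: (i \in P1); case: (j \in P1).
  - by move=> /(_ erefl) -> _; apply/scommZl/scommZr/(rel_yy hqL' hr' ij).
  - by move=> _ /(_ isT) ->; apply/scommZl/scommZr/(rel_yx hqL' hr' ij).
  - by move=> _ /(_ isT) ->; apply/scommZl/scommZr/(rel_xy hr' ij).
  - by move=> /(_ erefl) -> _; apply/scommZl/scommZr/(rel_xx hqL' hr' ij).
(* Stated for all distinct indices, this gives both mixed relations of the presentation. *)
have xy i j : i != j -> scomm (L j i) (imx i) (imy j).
  move=> /sij ij; rewrite /imy; apply/scommZl; move: (E1 j i) (E2 j i).
  case: (i \in P1); case: (j \in P1).
  - by move=> /(_ erefl) -> _; apply/scommZr/(rel_xy hr' ij).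
  - by move=> _ /(_ isT) ->; apply/scommZr/(rel_xx hqL' hr' ij).
  - by move=> _ /(_ isT) ->; apply/scommZr/(rel_yy hqL' hr' ij).
  - by move=> /(_ erefl) -> _; apply/scommZr/(rel_yx hqL' hr' ij).
split=> [i j ij|i].
  have ij' : i != j by rewrite neq_ltn ij.
  have ji' : j != i by rewrite eq_sym.
  by split; [apply: xx | apply: yy | apply: xy | apply: xy].
rewrite /imx /imy; case: (boolP (i \in P1)) => [/c1|/c2] qE.
  rewrite -!scalerAl -!scalerAr !scalerA mulfV // scale1r.
  by rewrite -mulrA mulVf // mulr1 -qE (proj2 hr').
rewrite -!scalerAl -!scalerAr !scalerA addrC -scaleNr -(proj2 hr' (sigma i)) qE.
rewrite -[X in _ = X - _]scale1r -scaleNr.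
by congr (_ *: _ + _ *: _); field; rewrite ?alpha0 ?q0.
Qed.

Lemma im_hom : exists phi : {lrmorphism A -> C},
  forall i, phi (x i) = imx i /\ phi (y i) = imy i.
Proof. by have [_ U] := hA; have [phi [Hphi _]] := U _ _ _ im_rel; exists phi. Qed.

End Converse.

(** The condition is symmetric in the two algebras, so the inverse map is built by the same
    construction. *)
Lemma qweyl_iso_cond_inv (K : fieldType) (n m : nat)
    (q : 'I_n -> K) (L : 'I_n -> 'I_n -> K) (q' : 'I_m -> K) (L' : 'I_m -> 'I_m -> K)
    (P1 : {set 'I_n}) (sigma : 'I_n -> 'I_m) (tau : 'I_m -> 'I_n) :
  qweyl_data q L -> qweyl_data q' L' -> cancel tau sigma ->
  qweyl_iso_cond q L q' L' P1 sigma ->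
  qweyl_iso_cond q' L' q L (tau @^-1: P1) tau.
Proof.
move=> [_ _ _ LV _] [_ _ _ LV' _] tauK [c1 c2 c3 c4].
split=> [k|k|k l|k l]; rewrite !inE.
- by move=> /c1; rewrite tauK.
- by move=> /c2; rewrite tauK => ->; rewrite invrK.
- by move=> /c3; rewrite !tauK.
by move=> kP /(c4 _ _ kP); rewrite !tauK => E; rewrite LV' E -LV.
Qed.

Lemma iso_of_cond (K : fieldType) (n m : nat)
    (q : 'I_n -> K) (L : 'I_n -> 'I_n -> K)
    (q' : 'I_m -> K) (L' : 'I_m -> 'I_m -> K)
    (A : algType K) (x y : 'I_n -> A) (C : algType K) (x' y' : 'I_m -> C)
    (P1 : {set 'I_n}) (sigma : 'I_n -> 'I_m) (alpha : 'I_n -> K) :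
  qweyl_data q L -> qweyl_data q' L' ->
  is_qweyl q L x y -> is_qweyl q' L' x' y' ->
  bijective sigma -> qweyl_iso_cond q L q' L' P1 sigma ->
  (forall i, alpha i != 0) ->
  exists phi : {lrmorphism A -> C}, bijective phi /\
    forall i, phi (x i) = imx x' y' P1 sigma alpha i /\
              phi (y i) = imy q x' y' P1 sigma alpha i.
Proof.
move=> hqL hqL' hA hC [tau sK tK] cond a0.
have [phi Hphi] := im_hom hqL hqL' hA hC (can_inj sK) cond a0.
have q0 i : q i != 0 by case: hqL.
(* These scalars make the second map inverse to the first. Outside [P1] the composite multiplies y_i
   by -beta / (q_i alpha_i), hence beta = -q_i alpha_i. *)
pose beta k := if tau k \in P1 then (alpha (tau k))^-1 else - q (tau k) * alpha (tau k).
have b0 k : beta k != 0.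
  rewrite /beta; case: ifP => _; first by rewrite invr_eq0.
  by rewrite mulf_neq0 // oppr_eq0.
have cond' := qweyl_iso_cond_inv hqL hqL' tK cond.
have [psi Hpsi] := im_hom hqL' hqL hC hA (can_inj tK) cond' b0.
have [_ c2 _ _] := cond.
exists phi; split=> //; exists psi.
  (* An endomorphism fixing the generators is the identity by the uniqueness part of the
     presentation. *)
  pose g : {lrmorphism A -> A} := psi \o phi.
  apply: (qweyl_hom_uniq hA (f := g) (g := idfun)) => i; rewrite /g /=.
  have [-> ->] := Hphi i; have := Hpsi (sigma i); rewrite /imx /imy /beta !inE sK.
  case: (boolP (i \in P1)) => iP [Ex Ey]; rewrite !linearZ_LR /= ?Ex ?Ey !scalerA.
    by rewrite invrK mulfV // mulVf // !scale1r.
  rewrite (c2 _ iP) invrK; split.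
    by rewrite -[RHS]scale1r; congr (_ *: _); field; rewrite ?oppr_eq0 ?q0 ?a0.
  by rewrite -[RHS]scale1r; congr (_ *: _); field; rewrite ?oppr_eq0 ?q0 ?a0.
pose g : {lrmorphism C -> C} := phi \o psi.
apply: (qweyl_hom_uniq hC (f := g) (g := idfun)) => k; rewrite /g /=.
have [-> ->] := Hpsi k; have := Hphi (tau k); rewrite /imx /imy /beta !inE tK.
case: (boolP (tau k \in P1)) => kP [Ex Ey]; rewrite !linearZ_LR /= ?Ex ?Ey !scalerA.
  by rewrite invrK mulfV // mulVf // !scale1r.
have := c2 _ kP; rewrite tK => ->; rewrite invrK; split.
  by rewrite -[RHS]scale1r; congr (_ *: _); field; rewrite ?oppr_eq0 ?q0 ?a0.
by rewrite -[RHS]scale1r; congr (_ *: _); field; rewrite ?oppr_eq0 ?q0 ?a0.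
Qed.

Theorem theorem2p3 (K : fieldType) (n m : nat)
    (q : 'I_n -> K) (L : 'I_n -> 'I_n -> K)
    (q' : 'I_m -> K) (L' : 'I_m -> 'I_m -> K)
    (A : algType K) (x y : 'I_n -> A)
    (C : algType K) (x' y' : 'I_m -> C) :
  qweyl_data q L -> qweyl_data q' L' ->
  (forall i, not_root_of_unity (q i)) ->
  (forall i, not_root_of_unity (q' i)) ->
  is_qweyl q L x y -> is_qweyl q' L' x' y' ->
  ((exists phi : {lrmorphism A -> C}, bijective phi) <->
   (m = n /\ exists (P1 : {set 'I_n}) (sigma : 'I_n -> 'I_m),
      bijective sigma /\ qweyl_iso_cond q L q' L' P1 sigma)) /\
  (forall (P1 : {set 'I_n}) (sigma : 'I_n -> 'I_m),
     bijective sigma -> qweyl_iso_cond q L q' L' P1 sigma ->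
     forall alpha : 'I_n -> K, (forall i, alpha i != 0) ->
     exists phi : {lrmorphism A -> C},
       bijective phi /\
       (forall i, i \in P1 ->
          phi (x i) = alpha i *: x' (sigma i) /\
          phi (y i) = (alpha i)^-1 *: y' (sigma i)) /\
       (forall i, i \notin P1 ->
          phi (x i) = alpha i *: y' (sigma i) /\
          phi (y i) = - ((q i)^-1 * (alpha i)^-1) *: x' (sigma i))).
Proof.
move=> hqL hqL' nru nru' hA hC; split; last first.
  move=> P1 sigma sB cond alpha a0.
  have [phi [phiB Hphi]] := iso_of_cond hqL hqL' hA hC sB cond a0.
  exists phi; split=> //; split=> i iP; have [-> ->] := Hphi i.
    by rewrite /imx /imy iP.
  by rewrite /imx /imy (negPf iP).
split=> [[phi /lrmorphism_inverse [psi [phiK psiK]]]|]; last first.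
  move=> [_ [P1 [sigma [sB cond]]]].
  have [|phi [phiB _]] := iso_of_cond (alpha := fun=> 1) hqL hqL' hA hC sB cond.
    by move=> i; apply: oner_neq0.
  by exists phi.
have [sigma [sI Hz]] := iso_z hqL hqL' nru nru' hA hC phiK psiK.
(* Only the injectivity of this second map matters: injections both ways give n = m, and then
   [sigma] is bijective. *)
have [tau [tI _]] := iso_z hqL' hqL nru' nru hC hA psiK phiK.
have nm : n = m.
  have := leq_card _ sI; have := leq_card _ tI; rewrite !card_ord => mn nm.
  by apply/eqP; rewrite eqn_leq nm mn.
split; first by rewrite nm.
have [P1 cond] := iso_cond hqL hqL' nru nru' hA hC phiK psiK sI nm Hz.
exists P1, sigma; split=> //.
by apply: inj_card_bij; rewrite ?card_ord ?nm.
Qed.
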